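(* Fix $n\ge2$ and $\alpha,\beta\in\mathbb R^n$, each with pairwise distinct coordinates. For every $w\in\mathbb R^{2n}$, every real singularity of the curve $C_w=V(h_w)\subset\mathbf P^2_{\mathbb R}$ is an ordinary multiple point with distinct real tangent lines, and all real singularities of $C_w$ lie in at most one fiber of $[x:y:t]\mapsto[y:t]$. Moreover, for every $2\le r\le n$, $$\Sigma_r=\bigcup_{\substack{S\subset\{1,\ldots,2n\}\\|S|=n-r}}\bigl(L_{\alpha,\beta}+\mathbb R^S\bigr),$$ and the subspaces in this union are $\binom{2n}{n-r}$ distinct linear subspaces of dimension $n-r+3$. In particular, $\Sigma_2$ is the locus of directions $w$ for which $C_w$ has a real singularity, and $\Sigma_n=L_{\alpha,\beta}$.
   Context: Finite free additive convolution: for $p(x)=\sum_{k=0}^n(-1)^ka_kx^{n-k}$ and $q(x)=\sum_{k=0}^n(-1)^kb_kx^{n-k}$ with $a_0=b_0=1$, set $(p\boxplus_n q)(x)=\sum_{k=0}^n(-1)^kc_kx^{n-k}$ with $c_k=\sum_{i+j=k}\frac{(n-i)!(n-j)!}{n!(n-k)!}a_ib_j$. $P_\alpha(x)=\prod_{i=1}^n(x-\alpha_i)$. For $w=u\oplus v\in\mathbb R^{2n}$ ($u,v\in\mathbb R^n$), $h_w(x,y,t)=(P_{y\alpha+tu}\boxplus_nP_{y\beta+tv})(x)$, a real homogeneous polynomial of degree $n$ in $(x,y,t)$, monic in $x$; for real $(y,t)$ all its $x$-roots are real. $L_{\alpha,\beta}=\operatorname{span}\{\mathbf 1_n\oplus0,\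 0\oplus\mathbf 1_n,\ \alpha^\circ\oplus\beta^\circ\}\subset\mathbb R^{2n}$, where $\mathbf 1_n$ is the all-ones vector and $\rho^\circ=\rho-\bar\rho\,\mathbf 1_n$, $\bar\rho=\frac1n\sum_i\rho_i$. For $S\subset\{1,\ldots,2n\}$, $\mathbb R^S=\operatorname{span}\{e_j:j\in S\}$ with $e_j$ the standard basis vectors of $\mathbb R^{2n}$. $\Sigma_r$ is the set of $w\in\mathbb R^{2n}$ for which there is a real parameter $[y:t]\in\mathbf P^1(\mathbb R)$ such that $h_w(x,y,t)$, as a polynomial in $x$, has a root of multiplicity at least $r$. An ordinary point of multiplicity $r$ of a plane curve is one whose lowest-degree homogeneous term in local affine coordinates is a product of $r$ pairwise nonproportional linear forms; here these forms are real. *)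

(* Defs.v *)
From HB Require Import structures.
From mathcomp Require Import all_boot all_order all_algebra.
From mathcomp Require Import reals.
From mathcomp Require Import mpoly.

Set Implicit Arguments.
Unset Strict Implicit.
Unset Printing Implicit Defensive.

Import Order.TTheory GRing.Theory Num.Theory.
Local Open Scope ring_scope.

(* Coefficients range over an R-algebra A, so that the convolution can be taken
   directly over the coefficient ring R[x, y, t]. *)
Section FiniteFreeConvolution.
Variables (R : fieldType) (A : algType R).

(* The a_k of p(x) = \sum_(k <= n) (-1)^k a_k x^(n - k). *)
Definition scoef (n : nat) (p : {poly A}) (k : nat) : A :=
  (-1) ^+ k * p`_(n - k).

Definition ffconv_coef (n : nat) (p q : {poly A}) (k : nat) : A :=
  \sum_(i < k.+1)
    (((n - i)`! * (n - (k - i))`!)%N%:R / (n`! * (n - k)`!)%N%:R : R)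
      *: (scoef n p i * scoef n q (k - i)).

Definition ffconv (n : nat) (p q : {poly A}) : {poly A} :=
  \sum_(k < n.+1) ((-1) ^+ k * ffconv_coef n p q k) *: 'X^(n - k).

Definition root_poly (n : nat) (a : 'I_n -> A) : {poly A} :=
  \prod_(i < n) ('X - (a i)%:P).

End FiniteFreeConvolution.

(* Homogeneous coordinates on P^2 are [x : y : t], in this order. *)
Definition ix : 'I_3 := @Ordinal 3 0 isT.
Definition iy : 'I_3 := @Ordinal 3 1 isT.
Definition it : 'I_3 := @Ordinal 3 2 isT.

Section PlaneCurves.
Variable R : fieldType.
Implicit Types (h : {mpoly R[3]}) (p : 'rV[R]_3).

(* A point of P^2(R) is represented by a nonzero vector p. *)
Definition singular_point h p : Prop :=
  [/\ p != 0, h.@[p 0] = 0 & forall i : 'I_3, (h^`M(i)).@[p 0] = 0].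

(* Equation of V(h) in the chart where coordinate i is 1 (used when
   p_i != 0), in the two affine coordinates centred at p. *)
Definition local_eq h p (i : 'I_3) : {mpoly R[2]} :=
  h \mPo [tuple (if unlift i j is Some k
                 then 'X_k + (p 0 j / p 0 i)%:MP else 1) | j < 3].

Definition hcomp (d : nat) (f : {mpoly R[2]}) : {mpoly R[2]} :=
  pihomog mdeg d f.

Definition lowest_term (f : {mpoly R[2]}) (r : nat) (g : {mpoly R[2]}) : Prop :=
  [/\ g = hcomp r f, g != 0 & forall d, (d < r)%N -> hcomp d f = 0].

Definition ordinary_point h p (r : nat) : Prop :=
  forall i : 'I_3, p 0 i != 0 ->
  exists l : 'I_r -> {mpoly R[2]},
    [/\ forall k, l k \is 1.-homog,
        forall k k', k != k' -> forall c : R, l k != c *: l k'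
      & lowest_term (local_eq h p i) r (\prod_(k < r) l k)].

(* p lies over [y : t]; in particular p is not the centre [1 : 0 : 0]. *)
Definition in_fiber (y t : R) p : Prop :=
  exists c : R, [/\ c != 0, p 0 iy = c * y & p 0 it = c * t].

(* h(x, y, t) as a polynomial in x, for fixed y and t. *)
Definition slice h (y t : R) : {poly R} :=
  mmap (@polyC R) (tnth [tuple 'X; y%:P; t%:P]) h.

End PlaneCurves.

Section Pencil.
Variables (R : realType) (n : nat).
Implicit Types (alpha beta rho : 'rV[R]_n) (w : 'rV[R]_(n + n)).

(* The entries of y rho + t u, as elements of R[x, y, t]. *)
Definition line_roots rho (u : 'rV[R]_n) (i : 'I_n) : {mpoly R[3]} :=
  rho 0 i *: 'X_iy + u 0 i *: 'X_it.

Definition curve alpha beta w : {mpoly R[3]} :=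
  (ffconv n (root_poly (line_roots alpha (lsubmx w)))
            (root_poly (line_roots beta (rsubmx w)))).['X_ix].

Definition mean rho : R := (\sum_(i < n) rho 0 i) / n%:R.

Definition centered rho : 'rV[R]_n := rho - mean rho *: const_mx 1.

Definition Lspace alpha beta : {vspace 'rV[R]_(n + n)} :=
  <<[:: row_mx (const_mx 1) 0; row_mx 0 (const_mx 1);
        row_mx (centered alpha) (centered beta)]>>%VS.

Definition coord_space (J : {set 'I_(n + n)}) : {vspace 'rV[R]_(n + n)} :=
  <<[seq delta_mx ord0 j | j <- enum J]>>%VS.

Definition Sigma alpha beta (r : nat) w : Prop :=
  exists y t : R, (y, t) != (0, 0) /\
    exists x : R, (r <= mup x (slice (curve alpha beta w) y t))%N.

(* The members L + R^J with |J| = m, listed once for each J. *)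
Definition strata alpha beta (m : nat) : seq {vspace 'rV[R]_(n + n)} :=
  [seq (Lspace alpha beta + coord_space J)%VS
     | J <- enum [set J : {set 'I_(n + n)} | #|J| == m]].

End Pencil.

(* Main.v *)
Require Import Defs.
From mathcomp Require Import all_boot all_order all_algebra.
From mathcomp Require Import reals.
From mathcomp Require Import mpoly.
From mathcomp Require Import complex.
From mathcomp Require Import ring lra zify.

(** Up to the factor n!, the convolution of p and q evaluated at a + b is
    \sum_k p^(k)(a) q^(n - k)(b).  It preserves real-rootedness, by Laguerre's
    theorem on polar derivatives.  If it has a double root x, moving two distinct
    roots of p must keep it real-rooted, and this rigidity forces x = a + b where
    the multiplicities of a in p and of b in q add up to n + mult(x).  So a
    singular point of C_w over [y : t] comes from index sets I and J on which
    y alpha + t u = a and y beta + t v = b, with |I| + |J| = n + r.  As alpha and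
    beta have distinct coordinates, two fibers cannot both carry such clusters,
    t is nonzero, and w lies in L + R^S with S the complement of I and J.
    Rescaling at the point, the lowest-degree term is the homogenization of the
    convolution of \prod_I (x - alpha_i) and \prod_J (x - beta_j); by the same
    criterion its r roots are real and simple, hence the distinct tangents. *)

Set Implicit Arguments.
Unset Strict Implicit.
Unset Printing Implicit Defensive.

Import Order.TTheory GRing.Theory Num.Theory.
Local Open Scope ring_scope.

(** The coefficient formula for the convolution gives no hold on roots. The derivative form has two
    symmetries, translation of each factor and simultaneous scaling of both, and all local
    statements follow from these. It is set up over integral domains because it is needed over R,
    over R[i] to locate roots, and over polynomial rings whose variable is the scaling parameter s
    of an expansion at a point. The rigidity comes from Laguerre's inequality f'^2 - f f'' >= 0.
    Along a real-rooted pencil f - s g it is a quadratic in s. At a double root x of f the constant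
    term vanishes, so the linear coefficient g(x) f''(x) must vanish as well. The total n + r is
    strong because each index set has at most n elements: both I and J keep at least r >= 2 indices,
    so distinctness of coordinates can be used on either side. *)

Section Pairing.
Variable A : idomainType.
Hypothesis char0 : [pchar A] =i pred0.
Implicit Types (P Q : {poly A}) (a b c s x : A).

Lemma deriv_eq0_const P : P^`() = 0 -> P = P.[0]%:P.
Proof.
move=> dP; apply/polyP => -[|k]; rewrite coefC ?horner_coef0 //=.
have := congr1 (fun q : {poly A} => q`_k) dP; rewrite coef_deriv coef0 -mulr_natr => /eqP.
by rewrite mulf_eq0 ((pcharf0P A).1 char0) orbF => /eqP.
Qed.

Lemma derivn_comp_affine P a s k :
  (P \Po (a%:P + s *: 'X))^`(k) = s ^+ k *: (P^`(k) \Po (a%:P + s *: 'X)).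
Proof.
elim: k => [|k IH]; first by rewrite expr0 scale1r.
rewrite derivnS IH derivZ deriv_comp -derivnS derivD derivC derivZ derivX add0r.
by rewrite -scalerAr mulr1 scalerA -exprSr.
Qed.

(* The convolution is translation covariant in each factor because this sum
   depends on (a, b) only through a + b. *)
Definition pairing n P Q a b : A := \sum_(k < n.+1) P^`(k).[a] * Q^`(n - k).[b].

Lemma pairing_sym n P Q a b : pairing n P Q a b = pairing n Q P b a.
Proof.
rewrite /pairing (reindex_inj rev_ord_inj) /=; apply: eq_bigr => k _.
by rewrite subSS subKn 1?mulrC // -ltnS.
Qed.

(** Along (a + x, b + c - x) the derivative of the pairing telescopes, and the two end terms contain
    P^(n+1) or Q^(n+1), which vanish by the size bounds. *)
Lemma pairing_shift n P Q a b c : (size P <= n.+1)%N -> (size Q <= n.+1)%N ->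
  pairing n P Q (a + c) b = pairing n P Q a (b + c).
Proof.
move=> sP sQ.
pose F := \sum_(k < n.+1) (P^`(k) \Po (a%:P + 1 *: 'X)) *
   (Q^`(n - k) \Po ((b + c)%:P + (- 1) *: 'X)).
have FE x : F.[x] = pairing n P Q (a + x) (b + c - x).
  rewrite horner_sum; apply: eq_bigr => k _.
  by rewrite hornerM !horner_comp !hornerE !mulN1r.
have dF : F^`() = 0.
  pose G k := (P^`(k) \Po (a%:P + 1 *: 'X)) *
      (Q^`(n.+1 - k) \Po ((b + c)%:P + (- 1) *: 'X)).
  have -> : F^`() = \sum_(0 <= k < n.+1) (G k.+1 - G k).
    have h1 q x e : (q \Po (x%:P + e *: 'X))^`() = e *: (q^`() \Po (x%:P + e *: 'X)).
      by have := derivn_comp_affine q x e 1; rewrite !derivn1 expr1.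
    rewrite big_mkord raddf_sum; apply: eq_bigr => -[k lk] _ /=.
    rewrite derivM !h1 /G subSS (derivnS P k) (subSn (_ : k <= n)%N) // (derivnS Q (n - k)).
    by rewrite !scale1r !scaleN1r mulrN.
  rewrite telescope_sumr //= /G subnn derivn_poly0 // comp_poly0 mul0r subn0.
  by rewrite (derivn_poly0 sQ) comp_poly0 mulr0 subrr.
have := congr1 (fun q : {poly A} => q.[c]) (deriv_eq0_const dF).
by rewrite hornerC !FE addrK addr0 subr0.
Qed.

(** Term k picks up s^k from one factor and s^(n-k) from the other, so all terms scale by the same
    s^n. *)
Lemma pairing_scale n P Q a b s x :
  pairing n (P \Po (a%:P + s *: 'X)) (Q \Po (b%:P + s *: 'X)) x 0 =
  s ^+ n * pairing n P Q (a + s * x) b.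
Proof.
rewrite mulr_sumr; apply: eq_bigr => k _.
rewrite !derivn_comp_affine !hornerZ !horner_comp !(hornerD, hornerC, hornerZ, hornerX) mulr0 addr0.
have -> : s ^+ n = s ^+ k * s ^+ (n - k) by rewrite -exprD subnKC // -ltnS.
by ring.
Qed.

Lemma pairingZl n c P Q a b : pairing n (c *: P) Q a b = c * pairing n P Q a b.
Proof. by rewrite mulr_sumr; apply: eq_bigr => k _; rewrite derivnZ hornerZ mulrA. Qed.

Lemma pairingZr n c P Q a b : pairing n P (c *: Q) a b = c * pairing n P Q a b.
Proof. by rewrite pairing_sym pairingZl pairing_sym. Qed.

(** Laguerre's polar derivative of Q with pole z, where Q is counted as having degree n. *)
Definition polar n z Q : {poly A} := n%:R *: Q + (z%:P - 'X) * Q^`().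

Lemma derivn_XsubC_mul P a k :
  (('X - a%:P) * P)^`(k) = ('X - a%:P) * P^`(k) + P^`(k.-1) *+ k.
Proof.
elim: k => [|k IH]; first by rewrite mulr0n addr0.
rewrite derivnS IH derivD derivM derivXsubC mul1r derivMn -!derivnS mulrSr.
by case: k {IH} => [|k] /=; ring.
Qed.

(** The coefficients of degree n+1 in (n+1) Q and in X Q' cancel. *)
Lemma size_polar n z Q : (size Q <= n.+2)%N -> (size (polar n.+1 z Q) <= n.+1)%N.
Proof.
move=> sQ; apply/leq_sizeP => j; rewrite leq_eqVlt => /orP[/eqP <-|lt].
  rewrite /polar coefD coefZ mulrBl coefB coefCM coefXM /= !coef_deriv.
  by rewrite [Q`_n.+2]nth_default // mul0rn mulr0 sub0r -[in X in _ - X]mulr_natl subrr.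
rewrite /polar coefD coefZ mulrBl coefB coefCM coefXM /= !coef_deriv.
have big m : (n.+1 < m)%N -> Q`_m = 0 by move=> h; rewrite nth_default // (leq_trans sQ).
case: j lt => // j lt; rewrite !big //; last by rewrite ltnW.
by rewrite /= !mul0rn !mulr0 subrr addr0.
Qed.

(** Shift the evaluation points to a and z = x - a. There X - a and z - X vanish, so Leibniz leaves
    (k+1) P^(k) on the left and the factor n+1-j on Q^(j) on the right; for j = n-k these weights
    agree. The pole depends on x, hence the pointwise form. *)
Lemma pairing_polar n P Q a x : (size P <= n.+1)%N -> (size Q <= n.+2)%N ->
  pairing n.+1 (('X - a%:P) * P) Q x 0 = pairing n P (polar n.+1 (x - a) Q) x 0.
Proof.
move=> sP sQ; set z := x - a.
have sXP : (size (('X - a%:P) * P)%R <= n.+2)%N.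
  by rewrite (leq_trans (size_polyMleq _ _)) // size_XsubC.
have sA := size_polar z sQ.
have dA j : (polar n.+1 z Q)^`(j) = (z%:P - 'X) * Q^`(j.+1) + Q^`(j) *+ n.+1 - Q^`(j) *+ j.
  have -> : polar n.+1 z Q = n.+1%:R *: Q - ('X - z%:P) * Q^`().
    by rewrite /polar -mulNr opprB.
  rewrite derivnB derivnZ derivn_XsubC_mul -derivSn scaler_nat.
  by case: j => [|j]; rewrite -?derivSn /=; ring.
have -> : x = a + z by rewrite addrC subrK.
rewrite !pairing_shift // add0r /pairing big_ord_recl derivn0 hornerM.
rewrite hornerXsubC subrr !mul0r add0r; apply: eq_bigr => k _.
rewrite subSS dA derivn_XsubC_mul !hornerE !subrr !mul0r !add0r /= !hornerMn.
rewrite -mulrnBr; last by lia.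
by rewrite (_ : n.+1 - (n - k) = k.+1)%N; [rewrite mulrnAl mulrnAr|have := ltn_ord k; lia].
Qed.

Definition conv n P Q : {poly A} := \sum_(k < n.+1) (Q^`(n - k)).[0] *: P^`(k).

Lemma horner_conv n P Q x : (conv n P Q).[x] = pairing n P Q x 0.
Proof. by rewrite horner_sum; apply: eq_bigr => k _; rewrite hornerZ mulrC. Qed.

Lemma conv_split n P Q a b : (size P <= n.+1)%N -> (size Q <= n.+1)%N ->
  (conv n P Q).[a + b] = pairing n P Q a b.
Proof. by move=> sP sQ; rewrite horner_conv pairing_shift // add0r. Qed.

Lemma convDl n P1 P2 Q : conv n (P1 + P2) Q = conv n P1 Q + conv n P2 Q.
Proof. by rewrite -big_split; apply: eq_bigr => k _; rewrite derivnD scalerDr. Qed.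

Lemma convZl n c P Q : conv n (c *: P) Q = c *: conv n P Q.
Proof. by rewrite scaler_sumr; apply: eq_bigr => k _; rewrite derivnZ !scalerA mulrC. Qed.

(** A degree missing in one factor is traded for a derivative of the other. *)
Lemma conv_lower n P Q : (size P <= n.+1)%N -> conv n.+1 P Q = conv n P Q^`().
Proof.
move=> sP; rewrite /conv big_ord_recr (derivn_poly0 sP) scaler0 /= addr0.
by apply: eq_bigr => k _; rewrite -derivSn subSn // -ltnS.
Qed.

Lemma deriv_conv n P Q : (size P <= n.+2)%N ->
  (conv n.+1 P Q)^`() = conv n P^`() Q^`().
Proof.
move=> sP; rewrite /conv raddf_sum big_ord_recr /= derivZ -(derivnS P n.+1).
rewrite (derivn_poly0 sP) scaler0 addr0.
apply: eq_bigr => -[k lk] _ /=.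
by rewrite derivZ (subSn (_ : k <= n)%N) // (derivSn Q (n - k)) -(derivnS P k) (derivSn P k).
Qed.

Lemma conv0n P Q : conv 0 P Q = Q.[0] *: P.
Proof. by rewrite /conv big_ord1. Qed.

End Pairing.

Lemma conv_map (A B : idomainType) (f : {rmorphism A -> B}) n (P Q : {poly A}) :
  map_poly f (conv n P Q) = conv n (map_poly f P) (map_poly f Q).
Proof.
rewrite rmorph_sum; apply: eq_bigr => k _ /=.
by rewrite map_polyZ !derivn_map -[in RHS](rmorph0 f) horner_map.
Qed.

(** * Root multiplicities in characteristic 0 *)

Section Multiplicity.
Variable F : fieldType.
Hypothesis char0 : [pchar F] =i pred0.
Implicit Types (p q : {poly F}) (a : F).

Lemma mup_factor p a : p != 0 ->
  exists2 q, p = q * ('X - a%:P) ^+ mup a p & ~~ root q a.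
Proof.
move=> p0; have [m [q]] := multiplicity_XsubC p a; rewrite p0 /= => nq Ep.
exists q => //; rewrite {1}Ep; congr (_ * _ ^+ _).
by rewrite Ep mupMr // mup_XsubCX eqxx.
Qed.

Lemma mup_gt0 p a : p != 0 -> (0 < mup a p)%N = root p a.
Proof. by move=> p0; rewrite -XsubC_dvd // dvdp_XsubCl. Qed.

Lemma mup_lt_size p a : p != 0 -> (mup a p < size p)%N.
Proof.
move=> p0; have [q Ep nq] := mup_factor a p0.
have q0 : q != 0 by apply: contraNneq nq => ->; rewrite root0.
rewrite {2}Ep size_proper_mul ?size_exp_XsubC; last first.
  by rewrite mulf_neq0 ?lead_coef_eq0 ?expf_neq0 ?polyXsubC_eq0.
by rewrite addnS /= -add1n leq_add2r size_poly_gt0.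
Qed.

Lemma mup_deriv p a : p != 0 -> root p a ->
  p^`() != 0 /\ mup a p = (mup a p^`()).+1.
Proof.
move=> p0 rp; have [q] := mup_factor a p0.
have : (0 < mup a p)%N by rewrite mup_gt0.
case: (mup a p) => // m _ Ep nq.
have E : p^`() = (q^`() * ('X - a%:P) + q *+ m.+1) * ('X - a%:P) ^+ m.
  rewrite Ep derivM deriv_exp derivXsubC mul1r exprS /=; ring.
have nr : ~~ root (q^`() * ('X - a%:P) + q *+ m.+1) a.
  rewrite /root !hornerE subrr mulr0 add0r hornerMn -mulr_natr mulf_neq0 //.
  by rewrite ((pcharf0P F).1 char0).
split; last by rewrite E mupMr // mup_XsubCX eqxx.
rewrite E mulf_neq0 ?expf_neq0 ?polyXsubC_eq0 //.
by apply: contraNneq nr => ->; rewrite root0.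
Qed.

Lemma mup_ge2 p a : p != 0 -> (2 <= mup a p)%N = root p a && root p^`() a.
Proof.
move=> p0; case rp: (root p a); last first.
  by apply/negbTE; rewrite -ltnNge ltnS -(mup_gt0 a p0) in rp *; lia.
by have [d0 ->] := mup_deriv p0 rp; rewrite ltnS mup_gt0.
Qed.
End Multiplicity.

(** * Stability in the upper half-plane and Laguerre's theorem *)

Section HalfPlane.
Variable R : rcfType.
Local Notation C := R[i].
Local Notation Re := complex.Re.
Local Notation Im := complex.Im.
Implicit Types (Q : {poly C}) (x z w : C).

(** For real coefficients this amounts to real-rootedness, but it also makes sense for the polar
    derivatives with nonreal poles that arise on the way. *)
Definition stable Q := forall x, 0 < Im x -> Q.[x] != 0.

(* The inverses 1 / (x - b) with Im b <= 0 fill a disc, which is convex, so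
   that their mean again lies in it. *)
Lemma sum_inv_disc x (s : seq C) : 0 < Im x -> (forall b, b \in s -> Im b <= 0) ->
  let w := \sum_(b <- s) (x - b)^-1 in
  Im x * (Re w ^+ 2 + Im w ^+ 2) + (size s)%:R * Im w <= 0 /\
  ((0 < size s)%N -> Im w < 0).
Proof.
move=> x0; elim: s => [|b s IH] hs /=.
  by rewrite big_nil /= mul0r expr0n /= !addr0 mulr0 lexx.
have {IH} [IH1 IH2] := IH (fun c h => hs c (mem_behead (s := b :: s) h)).
have hb : Im b <= 0 by apply: hs; rewrite mem_head.
rewrite big_cons; set w := \sum_(_ <- s) _ in IH1 IH2 *.
have [u0 hu] : Im (x - b)^-1 < 0 /\
    Im x * (Re (x - b)^-1 ^+ 2 + Im (x - b)^-1 ^+ 2) + Im (x - b)^-1 <= 0.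
  case: x x0 b hb {hs w IH1 IH2} => [x1 x2] /= x0 [b1 b2] /= hb.
  set D := (x1 - b1) ^+ 2 + (x2 - b2) ^+ 2.
  have D0 : 0 < D.
    by rewrite ltr_wpDl ?sqr_ge0 // exprn_gt0 // subr_gt0; lra.
  split; first by rewrite -mulNr mulrC pmulr_rlt0 ?invr_gt0 //; lra.
  have -> : x2 * (((x1 - b1) / D) ^+ 2 + (- ((x2 - b2) / D)) ^+ 2)
            + - ((x2 - b2) / D) = b2 / D.
    rewrite !sqrrN !exprMn -mulrDl -/D; field; exact: lt0r_neq0.
  by rewrite mulr_le0_ge0 // invr_ge0 ltW.
set u := (x - b)^-1 in u0 hu *.
have [ReD ImD] : Re (u + w) = Re u + Re w /\ Im (u + w) = Im u + Im w by case: (u); case: (w).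
rewrite ReD ImD; split=> [|_]; last first.
  case: s {hs} @w IH1 IH2 ReD ImD => [|c s] w IH1 IH2 _ _; last by have := IH2 isT; lra.
  by rewrite /w big_nil /= addr0.
case: s {hs} @w IH1 IH2 ReD ImD => [|c s] w IH1 IH2 _ _.
  by rewrite /w big_nil /= !addr0 mul1r.
have := IH2 isT; move: IH1 hu; rewrite /= -[(size s).+2%:R]natr1.
have : 0 < (size s).+1%:R :> R by rewrite ltr0n.
move: (size s).+1%:R (Im x) x0 (Re u) (Im u) u0 (Re w) (Im w) => N y y0 a b' _ c' d N0 h1 h2 _.
(* Convexity of the disc, for u = (a, b') and w = (c', d): since (N+1)(N|u|^2 + |w|^2) - N|u+w|^2 =
   |N u - w|^2, the left side is the sum of the expressions in [p1] and [p2] minus that in [sq]. *)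
suff : N * (y * ((a + c') ^+ 2 + (b' + d) ^+ 2) + (N + 1) * (b' + d)) <= 0.
  by rewrite pmulr_rle0.
have sq : 0 <= y * ((N * a - c') ^+ 2 + (N * b' - d) ^+ 2).
  by rewrite mulr_ge0 ?addr_ge0 ?sqr_ge0 // ltW.
have p1 : (N + 1) * N * (y * (a ^+ 2 + b' ^+ 2) + b') <= 0.
  by rewrite pmulr_rle0 // mulr_gt0 // addr_gt0.
have p2 : (N + 1) * (y * (c' ^+ 2 + d ^+ 2) + N * d) <= 0.
  by rewrite pmulr_rle0 // addr_gt0.
nra.
Qed.

Lemma deriv_prod_XsubC (s : seq C) x : (\prod_(b <- s) ('X - b%:P)).[x] != 0 ->
  (\prod_(b <- s) ('X - b%:P))^`().[x] =
  (\prod_(b <- s) ('X - b%:P)).[x] * \sum_(b <- s) (x - b)^-1.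
Proof.
elim: s => [|b s IH]; first by rewrite !big_nil -polyC1 derivC horner0 mulr0.
rewrite !big_cons hornerM mulf_eq0 negb_or hornerXsubC => /andP[xb ns].
rewrite derivM derivXsubC mul1r hornerD hornerM hornerXsubC IH //.
by field.
Qed.

(** The witness is the logarithmic derivative, the sum of 1/(x - b) over the roots b; this packaging
    hides the list of roots from the later arguments. *)
Lemma stable_log_deriv Q x : stable Q -> 0 < Im x -> exists w,
  [/\ Q^`().[x] = Q.[x] * w,
      Im x * (Re w ^+ 2 + Im w ^+ 2) + (size Q).-1%:R * Im w <= 0,
      (1 < size Q)%N -> Im w < 0 & (size Q <= 1)%N -> w = 0].
Proof.
move=> sQ x0; have [s Es] := closed_field_poly_normal Q.
have Q0 : Q != 0 by apply: contraNneq (sQ x x0) => ->; rewrite horner0.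
have l0 : lead_coef Q != 0 by rewrite lead_coef_eq0.
have hs b : b \in s -> Im b <= 0.
  move=> bs; rewrite leNgt; apply/negP => /sQ; rewrite Es hornerZ.
  by rewrite (rootP (_ : root _ b)) ?root_prod_XsubC // mulr0 eqxx.
have sz : size Q = (size s).+1 by rewrite Es size_scale // size_prod_XsubC.
have [h1 h2] := sum_inv_disc x0 hs.
exists (\sum_(b <- s) (x - b)^-1); split.
- have := sQ x x0; rewrite Es derivZ !hornerZ mulf_eq0 negb_or => /andP[_ n0].
  by rewrite deriv_prod_XsubC // mulrA.
- by rewrite sz.
- by rewrite sz.
- by rewrite sz; case: (s) => //; rewrite big_nil.
Qed.

(** Gauss-Lucas for a half-plane: the logarithmic derivative has negative imaginary part, so it is
    nonzero. *)
Lemma stable_deriv Q : stable Q -> (1 < size Q)%N -> stable Q^`().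
Proof.
move=> sQ s1 x x0; have [w [-> _ /(_ s1) w0 _]] := stable_log_deriv sQ x0.
rewrite mulf_neq0 ?sQ //; apply: contraTneq w0 => ->; by rewrite /= ltxx.
Qed.


(** A zero x of the polar derivative would satisfy (n+1) + (z - x) w = 0 with w the logarithmic
    derivative of Q at x. The disc inequality for w then places z outside the open upper
    half-plane. *)
Lemma stable_polar n Q z : stable Q -> (size Q <= n.+2)%N -> 0 < Im z ->
  stable (polar n.+1 z Q).
Proof.
move=> sQ sz z0 x x0; have [w [E h1 h2 h3]] := stable_log_deriv sQ x0.
rewrite /polar !hornerE E.
have -> : n.+1%:R * Q.[x] + (z - x) * (Q.[x] * w) = Q.[x] * (n.+1%:R + (z - x) * w).
  by ring.
rewrite mulf_neq0 ?sQ //.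
have [s1|s1] := leqP (size Q) 1; first by rewrite h3 // mulr0 addr0 pnatr_eq0.
have {}h2 := h2 s1.
have {sz} NM0 : (size Q).-1%:R <= n.+1%:R :> R.
  by rewrite ler_nat -ltnS prednK // (leq_trans _ s1).
apply/negP => /eqP eq.
have [e1 e2] : n.+1%:R + (Re z - Re x) * Re w - (Im z - Im x) * Im w = 0 /\
    (Re z - Re x) * Im w + (Im z - Im x) * Re w = 0.
  have N : n.+1%:R = (n.+1%:R)%:C%C :> C by rewrite rmorph_nat.
  move/eqP: eq; rewrite N; move: (n.+1%:R : R) => M.
  case: (z) (x) (w) => [z1 z2] [x1 x2] [w1 w2]; rewrite eq_complex /=.
  by move=> /andP[/eqP e1 /eqP e2]; split; [rewrite -[RHS]e1|rewrite -[RHS]e2]; ring.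
move: h1 h2 e1 e2 z0 x0 NM0; move: (n.+1%:R) ((size Q).-1%:R) => M N.
move: (Re z) (Im z) (Re x) (Im x) (Re w) (Im w) => z1 z2 x1 x2 w1 w2 h1 h2 e1 e2 z0 x0 NM.
(* Eliminating the real part of z - x gives Im z |w|^2 = Im x |w|^2 + M Im w, which the disc
   inequality bounds by (M - N) Im w <= 0. *)
have e3 : (z2 - x2) * (w1 ^+ 2 + w2 ^+ 2) = M * w2.
  have : w2 * (M + (z1 - x1) * w1 - (z2 - x2) * w2) - w1 * ((z1 - x1) * w2 + (z2 - x2) * w1) = 0.
    by rewrite e1 e2 !mulr0 subrr.
  by move=> h; apply/eqP; rewrite -subr_eq0 -oppr_eq0 -h; apply/eqP; ring.
have p : 0 < z2 * (w1 ^+ 2 + w2 ^+ 2).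
  by rewrite mulr_gt0 // ltr_wpDl ?sqr_ge0 // exprn_even_gt0 //= lt_eqF.
have : (M - N) * w2 <= 0 by rewrite mulr_ge0_le0 ?subr_ge0 // ltW.
lra.
Qed.

(** Each root a of the first factor is removed at the price of one polar derivative of Q with pole x
    - a, which lies in the upper half-plane because Im a <= 0 < Im x. *)
Lemma stable_conv (s : seq C) Q : (forall a, a \in s -> Im a <= 0) -> stable Q ->
  (size Q <= (size s).+1)%N -> stable (conv (size s) (\prod_(a <- s) ('X - a%:P)) Q).
Proof.
have char0 : [pchar C] =i pred0 by exact: pchar_num.
elim: s Q => [|a s IH] Q hs sQ sz x x0 /=.
  rewrite conv0n big_nil hornerZ hornerC mulr1.
  by have := sQ x x0; rewrite (size1_polyC sz) !hornerC.
rewrite big_cons horner_conv pairing_polar //; last by rewrite size_prod_XsubC.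
have ha := hs a (mem_head _ _).
have xa : 0 < Im (x - a) by move: x0 ha; case: (x) (a) => [x1 x2] [a1 a2] /=; lra.
rewrite -horner_conv; apply: IH => //.
- by move=> b bs; apply: hs; rewrite inE bs orbT.
- exact: stable_polar.
- exact: size_polar.
Qed.
End HalfPlane.

(** * Real-rooted polynomials and Laguerre's inequality *)

Section RealRooted.
Variable R : rcfType.
Local Notation C := R[i].
Local Notation Im := complex.Im.
Implicit Types (p q f g : {poly R}) (a b c x : R).

Let charR0 : [pchar R] =i pred0 := @pchar_num R.

Definition real_split p := exists c (s : seq R),
  c != 0 /\ p = c *: \prod_(a <- s) ('X - a%:P).

Lemma real_split_neq0 p : real_split p -> p != 0.
Proof.
case=> c [s [c0 ->]]; rewrite scaler_eq0 negb_or c0 /=.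
by rewrite monic_neq0 // monic_prod_XsubC.
Qed.

Lemma map_prod_XsubC (s : seq R) :
  map_poly (real_complex R) (\prod_(a <- s) ('X - a%:P)) =
  \prod_(z <- map (real_complex R) s) ('X - z%:P).
Proof.
rewrite rmorph_prod big_map; apply: eq_bigr => a _ /=.
by rewrite rmorphB /= map_polyX map_polyC.
Qed.

Lemma real_split_stable p : real_split p -> stable (map_poly (real_complex R) p).
Proof.
case=> c [s [c0 ->]] z z0; rewrite map_polyZ map_prod_XsubC hornerZ mulf_neq0 //.
  by rewrite fmorph_eq0.
rewrite -[_ != 0]/(~~ root _ _) root_prod_XsubC; apply/negP => /mapP[a _ Ez].
by move: z0; rewrite Ez /= ltxx.
Qed.

(** Conjugation fixes the coefficients, so a root in the lower half-plane would produce one in the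
    upper. *)
Lemma stable_real_split p : stable (map_poly (real_complex R) p) -> real_split p.
Proof.
move=> sp; set P := map_poly _ _ in sp.
have i0 : 0 < Im ('i%C : C) by rewrite /= ltr01.
have P0 : P != 0 by apply: contraNneq (sp _ i0) => ->; rewrite horner0.
have conjP : map_poly conjc P = P.
  rewrite /P -map_poly_comp; apply: eq_map_poly => a /=.
  by rewrite oppr0.
have [s Es] := closed_field_poly_normal P.
have l0 : lead_coef P != 0 by rewrite lead_coef_eq0.
have hs z : z \in s -> z = (complex.Re z)%:C%C.
  move=> zs; have rz : root P z by rewrite Es rootZ // root_prod_XsubC.
  have rzc : root P (conjc z) by rewrite -conjP fmorph_root.
  have : Im z = 0.
    apply/eqP; rewrite eq_le !leNgt; apply/andP; split; apply/negP => h.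
      by have := sp _ h; rewrite (rootP rz) eqxx.
    have h' : 0 < Im (conjc z) by move: h; case: (z) => u v /=; rewrite oppr_gt0.
    by have := sp _ h'; rewrite (rootP rzc) eqxx.
  by case: (z) => u v /= ->.
exists (lead_coef p), (map (@complex.Re R) s); split.
  by rewrite lead_coef_eq0 -(map_poly_eq0 (real_complex R)).
apply: (map_poly_inj (real_complex R)).
rewrite map_polyZ map_prod_XsubC -[LHS]/P {1}Es lead_coef_map -map_comp.
by congr (_ *: _); rewrite big_map; apply: eq_big_seq => z /hs {1}->.
Qed.

Lemma real_split_deriv p : real_split p -> (1 < size p)%N -> real_split p^`().
Proof.
move=> sp s1; apply: stable_real_split; rewrite -deriv_map.
by apply: stable_deriv; [exact: real_split_stable|rewrite size_map_poly].
Qed.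

Lemma real_split_conv n p q : real_split p -> real_split q ->
  size p = n.+1 -> (size q <= n.+1)%N -> real_split (conv n p q).
Proof.
case=> c [s [c0 ->]] sq; rewrite size_scale // size_prod_XsubC => -[<-] szq.
apply: stable_real_split; rewrite conv_map map_polyZ convZl map_prod_XsubC => x x0.
rewrite hornerZ mulf_neq0 ?fmorph_eq0 // -(size_map (real_complex R)).
apply: stable_conv => //; last by rewrite size_map_poly size_map.
  by move=> z /mapP[a _ ->].
exact: real_split_stable.
Qed.

(** With L(P) = P'^2 - P P'', one has L((X - a) P) = P^2 + (x - a)^2 L(P) at x. By induction L is
    nonnegative, and for a nonconstant product it vanishes only where the product does. *)
Lemma laguerre_ineq p x : real_split p ->
  0 <= p^`().[x] ^+ 2 - p.[x] * p^`()^`().[x] /\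
  ((1 < size p)%N -> p^`().[x] = 0 -> p^`()^`().[x] = 0 -> p.[x] = 0).
Proof.
case=> c [s [c0 ->]].
set P := \prod_(a <- s) _.
suff [h1 h2] : 0 <= P^`().[x] ^+ 2 - P.[x] * P^`()^`().[x] /\
    ((1 < size P)%N -> P^`().[x] ^+ 2 - P.[x] * P^`()^`().[x] = 0 -> P.[x] = 0).
  rewrite size_scale // !derivZ !hornerZ; split.
    have -> : (c * P^`().[x]) ^+ 2 - c * P.[x] * (c * P^`()^`().[x]) =
      c ^+ 2 * (P^`().[x] ^+ 2 - P.[x] * P^`()^`().[x]) by ring.
    by rewrite mulr_ge0 ?sqr_ge0.
  move=> s1 /eqP; rewrite mulf_eq0 (negPf c0) => /eqP d1 /eqP.
  rewrite mulf_eq0 (negPf c0) => /eqP d2; rewrite h2 ?mulr0 //.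
  by rewrite d1 d2 expr0n mulr0 subrr.
rewrite {}/P; elim: s => [|a s [IH _]].
  rewrite big_nil -polyC1 derivC deriv0 !horner0 expr0n mulr0 subrr lexx; split=> //.
  by rewrite size_polyC oner_eq0.
rewrite big_cons; set P := \prod_(_ <- s) _ in IH *.
have E : (('X - a%:P) * P)^`().[x] ^+ 2 - (('X - a%:P) * P).[x] * (('X - a%:P) * P)^`()^`().[x]
    = P.[x] ^+ 2 + (x - a) ^+ 2 * (P^`().[x] ^+ 2 - P.[x] * P^`()^`().[x]).
  have d1 : (('X - a%:P) * P)^`() = P + ('X - a%:P) * P^`() by rewrite derivM derivXsubC mul1r.
  have d2 : (('X - a%:P) * P)^`()^`() = P^`() + (P^`() + ('X - a%:P) * P^`()^`()).
    by rewrite d1 derivD derivM derivXsubC mul1r.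
  by rewrite d2 d1 !(hornerXsubC, hornerD, hornerM); ring.
rewrite E; split; first by rewrite addr_ge0 ?sqr_ge0 // mulr_ge0 ?sqr_ge0.
move=> _ /eqP; rewrite paddr_eq0 ?sqr_ge0 //; last by rewrite mulr_ge0 ?sqr_ge0.
by rewrite expf_eq0 /= => /andP[/eqP P0 _]; rewrite hornerM P0 mulr0.
Qed.

(** By the equality case of Laguerre's inequality, a multiple root of p' is a root of p. *)
Lemma mup_deriv_real_split p a : real_split p -> (2 <= mup a p^`())%N ->
  mup a p = (mup a p^`()).+1.
Proof.
move=> sp h; have p0 := real_split_neq0 sp.
have [s1|s1] := leqP (size p) 1.
  have d0 : p^`() = 0 by rewrite (size1_polyC s1) derivC.
  (* The multiplicity is a bounded ordinal, which makes it 0 for the zero polynomial and rules out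
     constant p. *)
  have : (mup a (0%R : {poly R}) < (size (0%R : {poly R})).+1)%N by exact: ltn_ord.
  by move: h; rewrite d0 size_poly0; lia.
have d0 : p^`() != 0 by rewrite -size_poly_eq0 polyorder.size_deriv; case: (size p) s1 => [|[]].
move: h; rewrite mup_ge2 // => /andP[/rootP r1 /rootP r2].
by apply: (mup_deriv charR0 p0 _).2; apply/rootP; apply: (laguerre_ineq a sp).2.
Qed.

Lemma real_split_pencil f g x : (forall s, real_split (f - s *: g)) ->
  f.[x] = 0 -> f^`().[x] = 0 -> f^`()^`().[x] != 0 -> g.[x] = 0.
Proof.
move=> h f0 f1 f2; apply/eqP; apply: contraNT f2 => g0.
set A := g^`().[x] ^+ 2 - g.[x] * g^`()^`().[x]; set B := g.[x] * f^`()^`().[x].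
suff : B = 0 by move/eqP; rewrite mulf_eq0 (negPf g0).
have hs s : 0 <= s ^+ 2 * A + s * B.
  have := (laguerre_ineq x (h s)).1; rewrite !(derivB, derivZ) !(hornerD, hornerN, hornerZ) f0 f1.
  set X := (X in 0 <= X -> _); suff -> : s ^+ 2 * A + s * B = X by [].
  by rewrite /X /A /B; ring.
(* At s = - B t the quadratic s^2 A + s B equals - B^2 t (1 - A t), which is negative for such t
   unless B = 0. *)
have [t t0 At] : exists2 t, 0 < t & A * t < 1.
  exists (A ^+ 2 + 1)^-1; first by rewrite invr_gt0 ltr_wpDl // sqr_ge0.
  rewrite ltr_pdivrMr ?ltr_wpDl ?sqr_ge0 // mul1r; nra.
have := hs (- B * t); have -> : (- B * t) ^+ 2 * A + - B * t * B = - (B ^+ 2 * (t * (1 - A * t))).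
  by ring.
rewrite oppr_ge0 pmulr_lle0 ?mulr_gt0 ?subr_gt0 // => B0.
by apply/eqP; rewrite -sqrf_eq0 eq_le B0 sqr_ge0.
Qed.
End RealRooted.

(** * Expansion of the pairing at a point and exact multiplicities *)

Section LocalExpansion.
Variable A : idomainType.
Hypothesis char0 : [pchar A] =i pred0.
Implicit Types (p q : {poly A}) (P Q : {poly {poly A}}) (a b x : {poly A}).

Lemma pchar_poly0 : [pchar {poly A}] =i pred0.
Proof. by apply/pcharf0P => n; rewrite -polyC_natr polyC_eq0 ((pcharf0P A).1 char0). Qed.

(** The variable ['X] of the coefficient ring is the scaling parameter s. Scaling contributes s^n
    and the two factors contribute s^(m1 + m2) = s^(n + r), so s^n can be cancelled. *)
Lemma pairing_local n r m1 m2 P Q P1 Q1 a b x : (m1 + m2 = n + r)%N ->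
  P \Po (a%:P + 'X%:P * 'X) = 'X^m1 *: P1 -> Q \Po (b%:P + 'X%:P * 'X) = 'X^m2 *: Q1 ->
  pairing n P Q (a + 'X * x) b = 'X^r * pairing n P1 Q1 x 0.
Proof.
move=> m12 EP EQ; apply: (mulfI (_ : 'X^n != 0 :> {poly A})); first by rewrite monic_neq0 ?monicXn.
have := pairing_scale n P Q a b 'X x.
by rewrite -mul_polyC EP EQ pairingZl pairingZr !mulrA -!exprD m12 => <-.
Qed.

Lemma pairing_horner0 n P Q x :
  (pairing n P Q x 0).[0] =
  pairing n (map_poly (horner_eval 0) P) (map_poly (horner_eval 0) Q) x.[0] 0.
Proof.
rewrite horner_sum; apply: eq_bigr => k _.
rewrite hornerM !derivn_map -!horner_evalE -!(horner_map (horner_eval 0)) /=.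
by rewrite [horner_eval 0 0]horner_evalE horner0.
Qed.

(** Only k = n - m2 survives: at 0 every other derivative of ['X^m2] vanishes. *)
Lemma pairing_monomials n m1 m2 (x : A) : (m1 <= n)%N -> (m2 <= n)%N -> (n <= m1 + m2)%N ->
  pairing n 'X^m1 'X^m2 x 0 = (m1 ^_ (n - m2) * m2`!)%:R * x ^+ (m1 + m2 - n).
Proof.
move=> h1 h2 h; have hk : (n - m2 < n.+1)%N by lia.
rewrite /pairing (bigD1 (Ordinal hk)) //= big1 ?addr0 => [|k nk].
  rewrite subKn // !derivnXn subnn ffactnn !hornerMn expr0 hornerXn hornerC.
  have -> : (m1 - (n - m2) = m1 + m2 - n)%N by lia.
  by rewrite -mulr_natr natrM; ring.
rewrite !derivnXn; apply/eqP; rewrite mulf_eq0; apply/orP; right.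
rewrite hornerMn hornerXn expr0n subn_eq0.
have [lt|] := ltnP m2 (n - k); first by rewrite ffact_small // mulr0n.
rewrite leq_eqVlt => /orP[/eqP e|lt]; last by rewrite leqNgt lt mul0rn.
by case/eqP: nk; apply: val_inj => /=; have := ltn_ord k; lia.
Qed.
End LocalExpansion.

Section ExactMultiplicity.
Variable F : fieldType.
Hypothesis char0 : [pchar F] =i pred0.
Implicit Types (p q : {poly F}) (a b : F).

(** Put x = a + b + s and extract s^r by scaling. At s = 0 the remaining factor is a pairing of
    monomials times p1(a) q1(b), where p1 and q1 are the cofactors; it is nonzero in characteristic
    0, so r is the exact order. *)
Lemma mup_conv n p q a b : size p = n.+1 -> size q = n.+1 ->
  (n <= mup a p + mup b q)%N ->
  conv n p q != 0 /\ mup (a + b) (conv n p q) = (mup a p + mup b q - n)%N.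
Proof.
move=> sp sq h.
have p0 : p != 0 by rewrite -size_poly_eq0 sp.
have q0 : q != 0 by rewrite -size_poly_eq0 sq.
have := mup_lt_size a p0; have := mup_lt_size b q0; rewrite sp sq !ltnS => h2 h1.
have [p1 Ep np1] := mup_factor a p0; have [q1 Eq nq1] := mup_factor b q0.
move: h h1 h2 Ep Eq; set m1 := mup a p; set m2 := mup b q => h h1 h2 Ep Eq.
set r := (m1 + m2 - n)%N; set f := conv n p q.
pose sub c (g : {poly F}) := map_poly polyC g \Po (c%:P%:P + 'X%:P * 'X).
have subE c (g : {poly F}) m : sub c (g * ('X - c%:P) ^+ m) = 'X^m *: ('X^m * sub c g).
  rewrite /sub rmorphM rmorphXn rmorphB /= map_polyX map_polyC /= comp_polyM.
  rewrite rmorphXn /= comp_polyB comp_polyX comp_polyC addrAC subrr add0r exprMn.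
  by rewrite -mul_polyC polyC_exp; ring.
have sub0 c (g : {poly F}) m :
    map_poly (horner_eval 0) ('X^m * sub c g) = g.[c] *: 'X^m.
  rewrite rmorphM rmorphXn /= map_polyX mulrC -mul_polyC; congr (_ * _).
  rewrite /sub map_comp_poly -map_poly_comp rmorphD rmorphM /= map_polyX !map_polyC /=.
  rewrite !horner_evalE hornerX mul0r addr0 hornerC.
  by rewrite (eq_map_poly (_ : _ =1 id)) ?map_poly_id // ?comp_polyCr // => u /=; rewrite horner_evalE hornerC.
pose K := pairing n ('X^m1 * sub a p1) ('X^m2 * sub b q1) 1 0.
have EK : f \Po ('X + (a + b)%:P) = 'X^r * K.
  rewrite -[LHS]/(map_poly polyC f).[_] conv_map polyCD addrC -addrA (addrC _ 'X) addrA.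
  rewrite conv_split ?size_map_polyC ?sp ?sq //; last exact: pchar_poly0.
  rewrite -[X in a%:P + X]mulr1; apply: (@pairing_local _ n r m1 m2); first by rewrite /r; lia.
    by rewrite {1}Ep; exact: subE.
  by rewrite {1}Eq; exact: subE.
have K0 : K.[0] != 0.
  rewrite pairing_horner0 !sub0 pairingZl pairingZr pairing_monomials // hornerC expr1n mulr1.
  rewrite !mulf_neq0 // ((pcharf0P F).1 char0) -lt0n muln_gt0 fact_gt0 ffact_gt0 andbT.
  by lia.
have Ef : f = (K \Po ('X - (a + b)%:P)) * ('X - (a + b)%:P) ^+ r.
  have := congr1 (fun g => g \Po ('X - (a + b)%:P)) EK.
  rewrite -comp_polyA comp_polyD comp_polyX comp_polyC subrK comp_polyXr => ->.
  by rewrite comp_polyM rmorphXn /= comp_polyX mulrC.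
have nr : ~~ root (K \Po ('X - (a + b)%:P)) (a + b).
  by rewrite /root horner_comp hornerXsubC subrr.
split; last by rewrite Ef mupMr // mup_XsubCX eqxx.
rewrite Ef mulf_neq0 ?expf_neq0 ?polyXsubC_eq0 //.
by apply: contraNneq nr => ->; rewrite root0.
Qed.
End ExactMultiplicity.

(** * Where a double root of a convolution comes from *)

Section DoubleRoots.
Variable R : rcfType.
Implicit Types (p q : {poly R}) (a b x : R).

Let charR0 : [pchar R] =i pred0 := @pchar_num R.

Lemma real_splitM p q : real_split p -> real_split q -> real_split (p * q).
Proof.
move=> [c [s [c0 ->]]] [d [t [d0 ->]]]; exists (c * d), (s ++ t).
by rewrite mulf_neq0 // big_cat /= -scalerAl -scalerAr scalerA.
Qed.

Lemma real_split_XsubC a : real_split ('X - a%:P).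
Proof. by exists 1, [:: a]; rewrite oner_neq0 big_seq1 scale1r. Qed.

Lemma mup_leq_mulr p g a : p * g != 0 -> (mup a g <= mup a (p * g))%N.
Proof. by rewrite mulf_eq0 negb_or => /andP[p0 g0]; rewrite mupM // leq_addl. Qed.

Lemma real_split_two_roots p : real_split p ->
  (exists c a, p = c *: ('X - a%:P) ^+ (size p).-1) \/
  (exists a1 a2 g, [/\ a1 != a2, real_split g & p = ('X - a1%:P) * (('X - a2%:P) * g)]).
Proof.
case=> c [[|a1 s] [c0 ->]].
  by left; exists c, 0; rewrite big_nil size_scale // size_poly1.
have [/all_pred1P E|] := boolP (all (pred1 a1) s).
  left; exists c, a1; rewrite size_scale // size_prod_XsubC /= E size_nseq.
  by rewrite big_cons big_nseq iter_mulr mulr1 -exprS.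
rewrite -has_predC => /hasP[a2 s2 /= ne]; right.
exists a1, a2, (c *: \prod_(a <- rem a2 s) ('X - a%:P)); split; first by rewrite eq_sym.
  by exists c, (rem a2 s).
by rewrite big_cons (perm_big _ (perm_to_rem s2)) big_cons /= -!scalerAr.
Qed.

(* Induction on n: either the root is more than double and one differentiates,
   or moving two distinct roots of p independently must preserve
   real-rootedness, which forces the convolution with these roots removed to
   vanish at x as well. *)
Theorem conv_double_root n p q x : real_split p -> real_split q ->
  size p = n.+1 -> size q = n.+1 -> (2 <= mup x (conv n p q))%N ->
  exists a b, a + b = x /\ (n + 2 <= mup a p + mup b q)%N.
Proof.
elim/ltn_ind: n p q => n IH p q sp sq zp zq dbl.
have both m u v : (m + 2 <= u + v)%N -> (u < m.+1)%N -> (v < m.+1)%N -> (2 <= u)%N /\ (2 <= v)%N.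
  by lia.
have sf : real_split (conv n p q) by apply: real_split_conv; rewrite ?zp ?zq.
have f0 := real_split_neq0 sf; have p0 := real_split_neq0 sp.
have q0 := real_split_neq0 sq.
case: n => [|n] in IH zp zq dbl sf f0 *.
  have : (size (conv 0 p q) <= 1)%N by rewrite conv0n (leq_trans (size_scale_leq _ _)) ?zp.
  by move=> h; have := leq_trans (leq_trans dbl (ltnW (mup_lt_size x f0))) h.
(* The exact multiplicity formula lowers the target: once the multiplicities reach the degree n+1,
   the assumed double root supplies the missing 2. *)
have exact a b : a + b = x -> (n.+1 <= mup a p + mup b q)%N ->
    exists a b, a + b = x /\ (n.+1 + 2 <= mup a p + mup b q)%N.
  move=> ab h; exists a, b; split => //.
  by have [_ E] := mup_conv charR0 zp zq h; rewrite -ab E in dbl; move: dbl h; move: (mup a p) (mup b q) => u v; lia.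
have sp' : size p^`() = n.+1 by rewrite polyorder.size_deriv zp.
have sq' : size q^`() = n.+1 by rewrite polyorder.size_deriv zq.
have rq' : real_split q^`() by apply: real_split_deriv; rewrite ?zq.
have rp' : real_split p^`() by apply: real_split_deriv; rewrite ?zp.
have Ef' : (conv n.+1 p q)^`() = conv n p^`() q^`() by rewrite deriv_conv ?zp.
move: (dbl); rewrite mup_ge2 // => /andP[/rootP fx /rootP f'x].
have [f''x|f''x] := eqVneq (conv n.+1 p q)^`()^`().[x] 0.
  have sf' : real_split (conv n p^`() q^`()) by apply: real_split_conv; rewrite ?sp' ?sq'.
  have : (2 <= mup x (conv n p^`() q^`()))%N.
    by rewrite -Ef' mup_ge2 ?Ef' ?real_split_neq0 // -Ef' /root f'x f''x eqxx.
  move=> /(IH _ (ltnSn n) _ _ rp' rq' sp' sq') [a [b [ab h]]].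
  have := mup_lt_size a (real_split_neq0 rp'); have := mup_lt_size b (real_split_neq0 rq').
  rewrite sp' sq' => hb ha; exists a, b; split => //.
  have [a2 b2] := both _ _ _ h ha hb.
  rewrite (mup_deriv_real_split sp a2) (mup_deriv_real_split sq b2).
  by move: h; move: (mup a _) (mup b _) => u v; lia.
(* If p is a multiple of a power of X - a, its multiplicity at a is already the full degree, and b =
   x - a works. *)
have [[c [a Ep]]|] := real_split_two_roots sp.
  apply: (exact a (x - a)); first by rewrite addrC subrK.
  have c0 : c != 0 by apply: contraNneq p0 => c0; rewrite Ep c0 scale0r.
  rewrite Ep zp -mul_polyC mupMr ?mup_XsubCX ?eqxx ?leq_addr //.
  by rewrite rootC.
move=> [a1 [a2 [g [ne sg Ep]]]].
have g0 := real_split_neq0 sg.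
have zM a (h : {poly R}) : h != 0 -> size (('X - a%:P) * h) = (size h).+1.
  by move=> h0; rewrite size_monicM ?monicXsubC // size_XsubC.
have zg : size g = n.
  by move: zp; rewrite Ep !zM ?mulf_neq0 ?polyXsubC_eq0 // => -[].
case: n => [|k] in zg IH exact dbl sf f0 zp zq sp' sq' Ef' fx f'x f''x *.
  by move/eqP: zg; rewrite size_poly_eq0 (negPf g0).
pose f1 v := conv k.+2 (('X - v%:P) * g) q.
have f1E v : f1 v = conv k.+1 (('X - v%:P) * g) q^`().
  by rewrite /f1 conv_lower // zM ?zg.
have shift_root u v (h : {poly R}) : ('X - (u + v)%:P) * h = ('X - u%:P) * h - v *: h.
  by rewrite polyCD opprD addrA mulrDl mulNr mul_polyC.
have convBZ m c (h1 h2 h3 : {poly R}) :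
    conv m (h1 - c *: h2) h3 = conv m h1 h3 - c *: conv m h2 h3.
  by rewrite -scaleNr convDl convZl scaleNr.
(* Moving the root u of p to u + s replaces the convolution f by f - s [f1 v], still real-rooted for
   every s, so the pencil lemma applies. *)
have pencil u v : p = ('X - u%:P) * (('X - v%:P) * g) -> (f1 v).[x] = 0.
  move=> E; apply: (@real_split_pencil _ (conv k.+2 p q)) => // s.
  rewrite -convBZ E -shift_root; apply: real_split_conv => //; last by rewrite zq.
    by do 2!(apply: real_splitM; first exact: real_split_XsubC).
  by rewrite !zM ?zg ?mulf_neq0 ?polyXsubC_eq0.
have f1a2 := pencil _ _ Ep.
have f1a1 : (f1 a1).[x] = 0 by apply: (pencil a2); rewrite Ep; ring.
pose G := conv k g q^`()^`().
have GE : conv k.+2 g q = G by rewrite !conv_lower // zg.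
have f1B u v : f1 (u + v) = f1 u - v *: G by rewrite /f1 shift_root convBZ GE.
(* [f1 a1] and [f1 a2] both vanish at x and differ by a nonzero multiple of [G], the convolution
   with both roots removed. *)
have Gx : G.[x] = 0.
  have := f1B a2 (a1 - a2); rewrite addrC subrK => /(congr1 (fun h => h.[x])).
  rewrite f1a1 hornerD hornerN hornerZ f1a2 sub0r => /esym/eqP.
  by rewrite oppr_eq0 mulf_eq0 subr_eq0 (negPf ne) => /eqP.
have leg a : (mup a g <= mup a p)%N.
  rewrite Ep mulrA; apply: mup_leq_mulr.
  by rewrite -mulrA -Ep.
have sq'' : size q^`()^`() = k.+1 by rewrite polyorder.size_deriv sq'.
(* If [G] has a double root, induction applies to g and q''; going back from q'' to q adds the two
   missing multiplicities. *)
have [G'x|G'x] := eqVneq G^`().[x] 0.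
  have rq'' : real_split q^`()^`() -> exists a b, a + b = x /\ (k.+2 + 2 <= mup a p + mup b q)%N.
    move=> rq''; have sG : real_split G by apply: real_split_conv; rewrite ?zg ?sq''.
    have : (2 <= mup x G)%N by rewrite mup_ge2 ?real_split_neq0 // /root Gx G'x eqxx.
    move=> /(IH k (ltnW (ltnSn _)) _ _ sg rq'' zg sq'') [a [b [ab h]]].
    have := mup_lt_size a g0; have := mup_lt_size b (real_split_neq0 rq'').
    rewrite zg sq'' => hb ha; exists a, b; split => //.
    have [_ b2] := both _ _ _ h ha hb.
    have E1 := mup_deriv_real_split rq' b2.
    rewrite (mup_deriv_real_split sq (_ : 2 <= mup b q^`())%N) E1 ?(leqW b2) //.
    move: (leg a) h.
    by move: (mup a g) (mup a p) (mup b _) => u v w; lia.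
  by apply: rq''; apply: real_split_deriv => //; rewrite sq'.
(* This value cancels the derivative at x: a fictitious root c next to g makes x a double root of
   the convolution with q'. Deleting c afterwards costs at most one multiplicity, and passing from
   q' to q regains it. *)
set c := (f1 0)^`().[x] / G^`().[x].
have f1c : f1 c = f1 0 - c *: G by rewrite -f1B add0r.
have f1_0 : (f1 0).[x] = 0.
  have := f1B a1 (- a1); rewrite subrr => ->.
  by rewrite hornerD hornerN hornerZ f1a1 Gx mulr0 subrr.
have zc : size (('X - c%:P) * g) = k.+2 by rewrite zM ?zg.
have rc : real_split (('X - c%:P) * g) by apply: real_splitM => //; exact: real_split_XsubC.
have rf1 : real_split (conv k.+1 (('X - c%:P) * g) q^`()).
  by apply: real_split_conv; rewrite ?sq'.
have : (2 <= mup x (conv k.+1 (('X - c%:P) * g) q^`()))%N.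
  rewrite mup_ge2 ?real_split_neq0 // -f1E f1c /root derivB derivZ.
  by rewrite !(hornerD, hornerN, hornerZ) f1_0 Gx mulr0 subrr eqxx /c divfK // subrr eqxx.
move=> /(IH k.+1 (ltnSn _) _ _ rc rq' zc sq') [a [b [ab h]]].
have := mup_lt_size a (real_split_neq0 rc); have := mup_lt_size b (real_split_neq0 rq').
rewrite zc sq' => hb ha; apply: (exact a b) => //.
have [_ b2] := both _ _ _ h ha hb.
have : (mup a (('X - c%:P) * g) <= 1 + mup a g)%N.
  rewrite mupM ?polyXsubC_eq0 // leq_add2r -['X - c%:P]expr1 mup_XsubCX.
  by case: eqP.
rewrite (mup_deriv_real_split sq b2); move: (leg a) h.
by move: (mup a g) (mup a p) (mup b _) (mup a _) => u v w y; lia.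
Qed.
End DoubleRoots.

(** * Convolutions of polynomials with simple roots *)

Section SimpleRoots.
Variable R : rcfType.
Implicit Types (p q : {poly R}) (x : R).

Let charR0 : [pchar R] =i pred0 := @pchar_num R.

(** Evaluation at the generic point ['X] turns the claim into symmetry and translation covariance of
    the pairing over {poly A}. *)
Lemma conv_sym (A : idomainType) n (P Q : {poly A}) : [pchar A] =i pred0 ->
  (size P <= n.+1)%N -> (size Q <= n.+1)%N -> conv n P Q = conv n Q P.
Proof.
move=> char0 sP sQ.
have E (S T : {poly A}) : conv n S T = pairing n (map_poly polyC S) (map_poly polyC T) 'X 0.
  by rewrite -horner_conv -conv_map -[LHS]comp_polyXr.
rewrite !E pairing_sym  -[X in _ = pairing _ _ _ X _]add0r.
by rewrite (pairing_shift (pchar_poly0 char0)) ?size_map_polyC // add0r.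
Qed.

Lemma size_conv n p q : size p = n.+1 -> size q = n.+1 -> size (conv n p q) = n.+1.
Proof.
move=> sp sq.
have c0 : (q^`(n)).[0] != 0.
  rewrite horner_coef0 coef_derivn addn0 -mulr_natr mulf_neq0 //.
    by have := lead_coef_eq0 q; rewrite lead_coefE sq -size_poly_eq0 sq => ->.
  by rewrite ((pcharf0P R).1 charR0) ffactnn -lt0n fact_gt0.
rewrite /conv big_ord_recl (_ : q^`(n - ord0).[0] *: p^`(ord0) = (q^`(n)).[0] *: p) ?subn0 //.
rewrite size_polyDl size_scale // sp ltnS.
apply/leq_sizeP => j nj; rewrite coef_sum big1 // => i _.
by rewrite coefZ coef_derivn nth_default ?mul0rn ?mulr0 // sp lift0 addSn ltnS (leq_trans nj) ?leq_addl.
Qed.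

Lemma simple_roots_derivn p k : real_split p -> (forall x, (mup x p <= 1)%N) ->
  (k < size p)%N -> real_split p^`(k) /\ forall x, (mup x p^`(k) <= 1)%N.
Proof.
move=> sp h; elim: k => [|k IH] hk; first by [].
have [sk hk1] := IH (ltnW hk); split.
  by rewrite derivnS; apply: real_split_deriv; rewrite // cauchyreals.size_derivn ltn_subRL addn1.
move=> x; rewrite derivnS leqNgt; apply/negP => h2.
by have := hk1 x; rewrite (mup_deriv_real_split sk h2) ltnS leqNgt ltnW.
Qed.

Lemma mup_uniq_prod_XsubC (s : seq R) x : uniq s ->
  (mup x (\prod_(a <- s) ('X - a%:P)) <= 1)%N.
Proof. by move=> us; rewrite mu_prod_XsubC count_uniq_mem // leq_b1. Qed.

Lemma conv_lowern n k p q : (size p <= n.+1)%N -> conv (n + k) p q = conv n p q^`(k).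
Proof.
move=> sp; elim: k q => [|k IH] q; first by rewrite addn0.
by rewrite addnS conv_lower ?IH -?derivSn // (leq_trans sp) // ltnS leq_addr.
Qed.

(** Trading missing degrees for derivatives on both sides gives a convolution at level r of two
    polynomials of degree exactly r. Their roots are still simple, so multiplicities sum to at most
    2 < r + 2 and no double root can occur. *)
Lemma conv_simple_roots n r (sa sb : seq R) : uniq sa -> uniq sb ->
  (size sa <= n)%N -> (size sb <= n)%N -> (size sa + size sb = n + r)%N -> (0 < r)%N ->
  exists c (g : seq R), [/\ c != 0, uniq g, size g = r &
    conv n (\prod_(a <- sa) ('X - a%:P)) (\prod_(b <- sb) ('X - b%:P)) =
    c *: \prod_(x <- g) ('X - x%:P)].
Proof.
move=> ua ub la lb Er r0.
set A := \prod_(a <- sa) _; set B := \prod_(b <- sb) _.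
have zA : size A = (size sa).+1 by rewrite size_prod_XsubC.
have zB : size B = (size sb).+1 by rewrite size_prod_XsubC.
have splitA : real_split A by exists 1, sa; rewrite oner_neq0 scale1r.
have splitB : real_split B by exists 1, sb; rewrite oner_neq0 scale1r.
pose B' := B^`(n - size sa); pose A' := A^`(n - size sb).
have [||sB' hB'] := @simple_roots_derivn B (n - size sa) splitB _ _.
- by move=> x; exact: mup_uniq_prod_XsubC.
- by rewrite zB; lia.
have [||sA' hA'] := @simple_roots_derivn A (n - size sb) splitA _ _.
- by move=> x; exact: mup_uniq_prod_XsubC.
- by rewrite zA; lia.
have zB' : size B' = r.+1 by rewrite cauchyreals.size_derivn zB; lia.
have zA' : size A' = r.+1 by rewrite cauchyreals.size_derivn zA; lia.
have EC : conv n A B = conv r B' A'.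
  rewrite -{1}(subnKC la) conv_lowern ?zA // conv_sym ?zA //; last first.
    by rewrite -/B' zB'; lia.
  rewrite -/B' (_ : size sa = (r + (n - size sb))%N); last by lia.
  by rewrite conv_lowern // zB'.
have sC : real_split (conv r B' A') by apply: real_split_conv; rewrite ?zA'.
have zC := size_conv zB' zA'.
have C1 x : (mup x (conv r B' A') <= 1)%N.
  rewrite leqNgt; apply/negP => /(conv_double_root sB' sA' zB' zA') [a [b [_]]].
  rewrite leqNgt (leq_ltn_trans (leq_add (hB' a) (hA' b))) //; lia.
case: sC => c [g [c0 Eg]]; exists c, g; split=> //; last by rewrite EC.
  apply: count_mem_uniq => x; have := C1 x; rewrite Eg.
  rewrite -mul_polyC mupMr ?rootC // mu_prod_XsubC => h.
  by move: h; case: (boolP (x \in g)) => [|/count_memPn -> //]; rewrite -has_pred1 has_count; case: (count _ _) => [|[]].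
by move: zC; rewrite Eg size_scale // size_prod_XsubC => -[].
Qed.
End SimpleRoots.

(** * Identification with the coefficient formula *)

Section Substitution.

Lemma pairing_map (A B : idomainType) (g : {rmorphism A -> B}) n (P Q : {poly A}) a b :
  g (pairing n P Q a b) = pairing n (map_poly g P) (map_poly g Q) (g a) (g b).
Proof.
rewrite rmorph_sum; apply: eq_bigr => k _.
by rewrite !derivn_map !horner_map rmorphM.
Qed.

Lemma mmap_comp_morph (R : nzRingType) (S T : comNzRingType) k (g : {rmorphism S -> T})
    (f : {rmorphism R -> S}) (v : 'I_k -> S) (h : {mpoly R[k]}) :
  g (mmap f v h) = mmap (g \o f) (g \o v) h.
Proof.
rewrite /mmap rmorph_sum; apply: eq_bigr => m _; rewrite rmorphM /=; congr (_ * _).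
by rewrite /mmap1 rmorph_prod; apply: eq_bigr => i _; rewrite rmorphXn.
Qed.

(** In degree j both sides sum p_(i+j) q_(n-i) with weight (i+j)! (n-i)! / j!, up to 1/n!: the signs
    cancel, and the summation index of the definition is n - j - i. *)
Lemma ffconv_conv (R : realType) k n (p q : {poly {mpoly R[k]}}) :
  (size p <= n.+1)%N -> (size q <= n.+1)%N ->
  ffconv n p q = (n`!%:R^-1 : R)%:MP_[k] *: conv n p q.
Proof.
move=> sp sq; apply/polyP => j; rewrite coefZ !coef_sum.
have [lj|lj] := ltnP n j.
  rewrite !big1 ?mulr0 // => i _.
    by rewrite coefZ coef_derivn nth_default ?mul0rn ?mulr0 // (leq_trans sp) // (leq_trans lj) ?leq_addl.
  by rewrite coefZ coefXn (_ : j == n - i = false)%N ?mulr0 //; apply/eqP; lia.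
have lk : (n - j < n.+1)%N by rewrite ltnS leq_subr.
rewrite (bigD1 (Ordinal lk)) //= [X in _ + X]big1 ?addr0 => [|i]; last first.
  rewrite -val_eqE /= coefZ coefXn => ni.
  by rewrite (_ : j == n - i = false)%N ?mulr0 //; apply/eqP; have := ltn_ord i; lia.
rewrite coefZ coefXn subKn // eqxx mulr1.
set k0 := (n - j)%N.
pose G i : {mpoly R[k]} := q^`(n - i).[0] * p^`(i)`_j.
have -> : \sum_(i < n.+1) (q^`(n - i).[0] *: p^`(i))`_j = \sum_(i < k0.+1) G i.
  rewrite [RHS](big_ord_widen n.+1 G) // [RHS]big_mkcond; apply: eq_bigr => i _.
  rewrite coefZ -/(G i); case: ifP => // /negbT; rewrite -leqNgt => hi.
  by rewrite /G coef_derivn nth_default ?mul0rn ?mulr0 // (leq_trans sp) //; rewrite /k0 in hi; lia.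
rewrite /ffconv_coef !mulr_sumr (reindex_inj rev_ord_inj) /=; apply: eq_bigr => -[i hi] _ /=.
have {}hi : (i <= k0)%N by [].
rewrite subSS subKn // /G horner_coef0 !coef_derivn addn0 ffactnn.
rewrite /scoef (_ : n - (k0 - i) = i + j)%N; last by rewrite /k0 in hi *; lia.
rewrite (_ : n - k0 = j)%N; last by rewrite /k0 subKn.
rewrite mul_mpolyC -scalerAr.
have -> : (-1) ^+ k0 * ((-1) ^+ (k0 - i) * p`_(i + j) * ((-1) ^+ i * q`_(n - i)))
    = p`_(i + j) * q`_(n - i).
  rewrite -(subnK hi) addnK exprD; move: (p`_ _) (q`_ _) => u v.
  have e (m : nat) : ((-1) ^+ m * (-1) ^+ m = 1 :> {mpoly R[k]}) by rewrite -expr2 sqrr_sign.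
  transitivity (((-1) ^+ (k0 - i) * (-1) ^+ (k0 - i)) * ((-1) ^+ i * (-1) ^+ i) * (u * v)); first by ring.
  by rewrite !e !mul1r.
rewrite [in RHS]mulrnAr [in RHS]mulrnAl [in RHS](mulrC (q`_(n - i))) -mulrnA.
rewrite -[in RHS]scaler_nat scalerA; congr (_ *: _).
have F m : m`!%:R != 0 :> R by rewrite pnatr_eq0 -lt0n fact_gt0.
have := ffact_fact (leq_addr j i); rewrite addKn => <-.
by rewrite !natrM; field; rewrite !F.
Qed.
End Substitution.

(** * Restriction to lines and homogeneous components *)

Section Evaluation.
Variable R : realType.

Lemma mmap_ext (S T : nzRingType) k (f f' : S -> T) (v v' : 'I_k -> T) h :
  f =1 f' -> v =1 v' -> mmap f v h = mmap f' v' h.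
Proof.
move=> ef ev; apply: eq_bigr => m _; rewrite ef; congr (_ * _).
by apply: eq_bigr => i _; rewrite ev.
Qed.

Lemma mpoly_alg_ind (k : nat) (P : {mpoly R[k]} -> Prop) :
  (forall c, P c%:MP_[k]) -> (forall i, P 'X_i) ->
  (forall p q, P p -> P q -> P (p + q)) -> (forall p q, P p -> P q -> P (p * q)) ->
  forall p, P p.
Proof.
move=> hC hX hD hM; have h0 : P 0 by have := hC 0; rewrite mpolyC0.
have h1 : P 1 by have := hC 1; rewrite mpolyC1.
elim/mpolyind => [//|c m p _ _ Pp]; apply: (hD) => //.
rewrite -mul_mpolyC; apply: (hM) => //; rewrite mpolyXE_id.
apply: big_ind => // i _; elim: (m i) => [|j IH]; first by rewrite expr0.
by rewrite exprS; apply: hM.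
Qed.

Lemma meval_line (k : nat) (p d : 'I_k -> R) (h : {mpoly R[k]}) :
  let g := mmap (@polyC R) (fun j => (p j)%:P + 'X * (d j)%:P) h in
  g.[0] = h.@[p] /\ g^`().[0] = \sum_i d i * (h^`M(i)).@[p].
Proof.
pose phi := mmap (@polyC R) (fun j => (p j)%:P + 'X * (d j)%:P).
rewrite -/(phi h) /=; move: h; apply: mpoly_alg_ind => [c|i|f g [f0 f1] [g0 g1]|f g [f0 f1] [g0 g1]].
- rewrite /phi mmapC hornerC mevalC derivC horner0 big1 // => i _.
  by rewrite mderivC meval0 mulr0.
- rewrite /phi mmapX mmap1U hornerD hornerM hornerX !hornerC mul0r addr0 mevalXU; split=> //.
  rewrite derivD derivC add0r derivM derivX derivC mulr0 addr0 mul1r hornerC.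
  rewrite (bigD1 i) //= big1 ?addr0 => [|j ji].
    have -> : ('X_i : {mpoly R[k]})^`M(i) = 1.
      by rewrite mderivX mnm1E eqxx scale1r -[X in 'X_[X]](_ : 0%MM = _) ?mpolyX0 //; apply/mnmP => j; rewrite mnmBE mnm0E subnn.
    by rewrite meval1 mulr1.
  by rewrite mderivX mnm1E eq_sym (negPf ji) scale0r meval0 mulr0.
- rewrite /phi !mmapD -/phi derivD !hornerD f0 g0 f1 g1 mevalD; split=> //.
  by rewrite -big_split; apply: eq_bigr => i _; rewrite mderivD mevalD mulrDr.
- have -> : phi (f * g) = phi f * phi g by rewrite /phi rmorphM.
  rewrite derivM hornerD !hornerM f0 g0 f1 g1 mevalM; split=> //.
  rewrite mulr_suml mulr_sumr -big_split; apply: eq_bigr => i _.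
  by rewrite /= mderivM mevalD !mevalM; ring.
Qed.

(** Scaling both coordinates by s multiplies the degree d part by s^d, so components can be read off
    as coefficients in s. *)
Lemma hcomp_coef (f : {mpoly R[2]}) d :
  (mmap (polyC \o @mpolyC 2 R) (fun k => 'X * ('X_k)%:P) f)`_d = hcomp d f.
Proof.
rewrite /hcomp pihomogE /mmap coef_sum [RHS]big_mkcond; apply: eq_bigr => m _ /=.
have -> : mmap1 (fun k : 'I_2 => 'X * ('X_k)%:P) m = 'X^(mdeg m) * ('X_[m] : {mpoly R[2]})%:P.
  rewrite mdegE mpolyXE_id rmorph_prod -prodrXr -big_split; apply: eq_bigr => i _.
  by rewrite exprMn rmorphXn.
rewrite coefCM coefXnM; case: ltngtP => [lt|gt|<-]; first by rewrite mulr0.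
  by rewrite coefC subn_eq0 leqNgt gt mulr0.
by rewrite subnn coefC eqxx mul_mpolyC.
Qed.

Definition chart_dir (i j : 'I_3) : {mpoly R[2]} :=
  if unlift i j is Some k then 'X_k else 0.

(** Scaling the chart coordinates by s means moving from p / p_i along s times a generic direction
    tangent to the chart, which is the form in which the curve is expanded below. *)
Lemma local_eq_scale h (p : 'rV[R]_3) i : p 0 i != 0 ->
  mmap (polyC \o @mpolyC 2 R) (fun k => 'X * ('X_k)%:P) (local_eq h p i) =
  mmap (polyC \o @mpolyC 2 R)
    (fun j => ((p 0 j / p 0 i)%:MP_[2])%:P + 'X * (chart_dir i j)%:P) h.
Proof.
move=> pi0; rewrite /local_eq /comp_mpoly.
pose psi : {rmorphism {mpoly R[2]} -> {poly {mpoly R[2]}}} :=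
  mmap (polyC \o @mpolyC 2 R) (fun k => 'X * ('X_k)%:P).
rewrite -[LHS]/(psi _) (mmap_comp_morph psi); apply: mmap_ext => [c|j] /=.
  by rewrite mmapC.
rewrite tnth_mktuple /chart_dir; case: unliftP => [k _|->] /=.
  by rewrite mmapD mmapX mmap1U mmapC addrC.
by rewrite rmorph1 divff // mulr0 addr0.
Qed.
End Evaluation.

Lemma size_prod_XsubC_ord (A : comNzRingType) n (c : 'I_n -> A) :
  size (\prod_(i < n) ('X - (c i)%:P)) = n.+1.
Proof.
have -> : \prod_(i < n) ('X - (c i)%:P) = \prod_(i <- enum 'I_n) ('X - (c i)%:P).
  by rewrite big_enum.
by rewrite size_prod_XsubC size_enum_ord.
Qed.

Section RootSets.
Variables (F : fieldType) (n : nat).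
Implicit Types (c : 'I_n -> F) (a : F).

Definition rootset c a := [set i : 'I_n | c i == a].

Lemma prod_XsubC_ord c :
  \prod_(i < n) ('X - (c i)%:P) = \prod_(x <- map c (enum 'I_n)) ('X - x%:P).
Proof. by rewrite big_map big_enum. Qed.

Lemma mup_prod_XsubC_ord c a : mup a (\prod_(i < n) ('X - (c i)%:P)) = #|rootset c a|.
Proof.
rewrite prod_XsubC_ord mu_prod_XsubC count_map -sum1_count big_enum_cond -sum1_card.
by apply: eq_bigl => i; rewrite !inE.
Qed.

End RootSets.

(** * The curve and its fibers *)

Section Curve.
Variables (R : realType) (n : nat) (alpha beta : 'rV[R]_n).
Implicit Types (w : 'rV[R]_(n + n)) (rho u : 'rV[R]_n).

Let charR0 : [pchar R] =i pred0 := @pchar_num R.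

Definition fiber_root rho u (y t : R) (i : 'I_n) : R := rho 0 i * y + u 0 i * t.

Definition fiber_poly rho u y t : {poly R} :=
  \prod_(i < n) ('X - (fiber_root rho u y t i)%:P).

(** The target ring is arbitrary so that one formula serves slices, real lines through a point, and
    generic directions in a chart. *)
Lemma mmap_curve (B : idomainType) (f : {rmorphism R -> B}) (v : 'I_3 -> B) w :
  let lines rho u := \prod_(i < n) ('X - (f (rho 0 i) * v iy + f (u 0 i) * v it)%:P) in
  mmap f v (curve alpha beta w) =
  f (n`!%:R^-1) * pairing n (lines alpha (lsubmx w)) (lines beta (rsubmx w)) (v ix) 0.
Proof.
move=> lines.
have sz rho u : (size (root_poly (line_roots rho u)) <= n.+1)%N.
  by rewrite /root_poly size_prod_XsubC_ord.
have E rho u : map_poly (mmap f v) (root_poly (line_roots rho u)) = lines rho u.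
  rewrite rmorph_prod; apply: eq_bigr => i _.
  rewrite rmorphB /= map_polyX map_polyC /=; congr ('X - _%:P).
  by rewrite /line_roots mmapD !mmapZ !mmapX !mmap1U.
rewrite /curve ffconv_conv // hornerZ horner_conv rmorphM /= mmapC; congr (_ * _).
by rewrite pairing_map /= !E mmapX mmap1U rmorph0.
Qed.

Lemma slice_line w (y t : R) (z : {poly R}) :
  mmap (@polyC R) (fun j => if j == ix then z else if j == iy then y%:P else t%:P)
    (curve alpha beta w) =
  n`!%:R^-1 *: (conv n (fiber_poly alpha (lsubmx w) y t) (fiber_poly beta (rsubmx w) y t) \Po z).
Proof.
rewrite (mmap_curve (@polyC R)) /= mul_polyC; congr (_ *: _).
have E rho u : \prod_(i < n) ('X - ((rho 0 i)%:P * y%:P + (u 0 i)%:P * t%:P)%:P) =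
    map_poly polyC (fiber_poly rho u y t).
  rewrite rmorph_prod; apply: eq_bigr => i _.
  rewrite rmorphB /= map_polyX map_polyC /=; congr ('X - _%:P).
  by rewrite /fiber_root polyCD !polyCM.
by rewrite !E -horner_conv -conv_map.
Qed.

Lemma size_fiber_poly rho u y t : size (fiber_poly rho u y t) = n.+1.
Proof. exact: size_prod_XsubC_ord. Qed.

Lemma real_split_fiber_poly rho u y t : real_split (fiber_poly rho u y t).
Proof.
exists 1, (map (fiber_root rho u y t) (enum 'I_n)).
by rewrite oner_neq0 scale1r -prod_XsubC_ord.
Qed.

Definition fiber_conv w y t :=
  conv n (fiber_poly alpha (lsubmx w) y t) (fiber_poly beta (rsubmx w) y t).

Definition fiber_mult w y t a b := (#|rootset (fiber_root alpha (lsubmx w) y t) a| +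
  #|rootset (fiber_root beta (rsubmx w) y t) b|)%N.

Lemma fiber_conv_neq0 w y t : fiber_conv w y t != 0.
Proof.
apply: real_split_neq0; apply: real_split_conv;
  by rewrite ?size_fiber_poly //; exact: real_split_fiber_poly.
Qed.

Lemma fiber_conv_mult w y t a b : (n <= fiber_mult w y t a b)%N ->
  mup (a + b) (fiber_conv w y t) = (fiber_mult w y t a b - n)%N.
Proof.
rewrite /fiber_mult -!mup_prod_XsubC_ord => h.
exact: (mup_conv charR0 (size_fiber_poly _ _ _ _) (size_fiber_poly _ _ _ _) h).2.
Qed.

Lemma fiber_conv_double w y t x : (2 <= mup x (fiber_conv w y t))%N ->
  exists a b, a + b = x /\ fiber_mult w y t a b = (n + mup x (fiber_conv w y t))%N.
Proof.
move=> h; have [a [b [ab hab]]] := conv_double_root (real_split_fiber_poly _ _ _ _)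
  (real_split_fiber_poly _ _ _ _) (size_fiber_poly _ _ _ _) (size_fiber_poly _ _ _ _) h.
exists a, b; split => //; rewrite !mup_prod_XsubC_ord -/(fiber_mult w y t a b) in hab.
have le : (n <= fiber_mult w y t a b)%N by rewrite (leq_trans _ hab) // leq_addr.
by rewrite -ab fiber_conv_mult // subnKC.
Qed.
End Curve.

(** * The lowest-degree term at a point of the curve *)

Section LowestTerm.
Variable R : realType.

Let charR0 : [pchar R] =i pred0 := @pchar_num R.

(* Substituting a + 's X pulls out one factor s for each root of the cluster
   c i = a, and the other factors become nonzero constants at s = 0. *)
Lemma prod_XsubC_local (A : idomainType) (f : {rmorphism R -> A}) n
    (c : 'I_n -> R) (l : 'I_n -> A) (a : R) :
  let P : {poly {poly A}} := \prod_(i < n) ('X - ((f (c i))%:P + 'X * (l i)%:P)%:P) in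
  exists P1 : {poly {poly A}}, exists2 k : R, k != 0 &
    P \Po ((f a)%:P%:P + 'X%:P * 'X) = 'X^#|rootset c a| *: P1 /\
    map_poly (horner_eval 0) P1 = f k *: \prod_(i in rootset c a) ('X - (l i)%:P).
Proof.
pose s : {poly {poly A}} := 'X%:P.
pose U := \prod_(i in ~: rootset c a) ((f (a - c i))%:P%:P + s * ('X - (l i)%:P%:P)).
exists (\prod_(i in rootset c a) ('X - (l i)%:P%:P) * U).
exists (\prod_(i in ~: rootset c a) (a - c i)).
  by apply/prodf_neq0 => i; rewrite !inE subr_eq0 eq_sym.
split.
  rewrite rmorph_prod (bigID (mem (rootset c a))) /= -mul_polyC mulrA.
  have -> : (('X^#|rootset c a|)%:P : {poly {poly A}}) = \prod_(i in rootset c a) s.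
    by rewrite prodr_const polyC_exp.
  rewrite -big_split /=; congr (_ * _).
    apply: eq_bigr => i; rewrite inE => /eqP ci.
    by rewrite comp_polyB comp_polyX comp_polyC ci /s !polyCD !polyCM; ring.
  apply: eq_big => [i|i _]; first by rewrite !inE.
  by rewrite comp_polyB comp_polyX comp_polyC rmorphB /= /s !(polyCD, polyCM, polyCN); ring.
have e0 (q : {poly A}) : horner_eval 0 q = q.[0] by rewrite horner_evalE.
rewrite rmorphM /= mulrC -mul_polyC; congr (_ * _).
  rewrite !rmorph_prod /=; apply: eq_bigr => i _.
  move: (f (a - c i)) => z.
  rewrite rmorphD rmorphM rmorphB /= map_polyX !map_polyC /= !e0 hornerX mul0r addr0.
  by rewrite hornerC.
rewrite rmorph_prod /=; apply: eq_bigr => i _.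
by rewrite rmorphB /= map_polyX !map_polyC /= e0 hornerC.
Qed.

Lemma prod_const_seq (A : nzRingType) (T : Type) (S : seq T) (x : A) :
  \prod_(y <- S) x = x ^+ size S.
Proof. by rewrite big_const_seq count_predT /= iter_mulr_1. Qed.

(** The roots are images of I and J under affine maps with common slope sigma, so translation and
    scaling reduce to the given convolution at rho / sigma; clearing denominators homogenizes it. *)
Lemma pairing_homog (K : fieldType) (f : {rmorphism R -> K}) n (I J : seq R) (g : seq R) C
    (sigma rho lambda mu : K) : sigma != 0 ->
  (size I <= n)%N -> (size J <= n)%N -> (size I + size J = n + size g)%N ->
  conv n (\prod_(x <- I) ('X - x%:P)) (\prod_(x <- J) ('X - x%:P)) =
    C *: \prod_(x <- g) ('X - x%:P) ->
  pairing n (\prod_(x <- I) ('X - (f x * sigma + lambda)%:P))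
            (\prod_(x <- J) ('X - (f x * sigma + mu)%:P)) (rho + lambda + mu) 0 =
  f C * \prod_(x <- g) (rho - f x * sigma).
Proof.
move=> s0 zI zJ zIJ E.
have char0 : [pchar K] =i pred0.
  by apply/pcharf0P => m; rewrite -(rmorph_nat f) fmorph_eq0 ((pcharf0P R).1 charR0).
have sc (S : seq R) nu : \prod_(x <- S) ('X - (f x * sigma + nu)%:P) \Po (nu%:P + sigma *: 'X) =
    sigma ^+ size S *: map_poly f (\prod_(x <- S) ('X - x%:P)).
  rewrite !rmorph_prod /= -[in RHS]mul_polyC -(prod_const_seq S) rmorph_prod -big_split /=.
  apply: eq_bigr => x _; rewrite comp_polyB comp_polyX comp_polyC rmorphB /= map_polyX map_polyC /=.
  by rewrite -mul_polyC polyCD polyCM; ring.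
have := pairing_scale n (\prod_(x <- I) ('X - (f x * sigma + lambda)%:P))
  (\prod_(x <- J) ('X - (f x * sigma + mu)%:P)) lambda mu sigma (rho / sigma).
rewrite !sc pairingZl pairingZr (mulrC sigma (rho / sigma)) divfK //.
rewrite -horner_conv -conv_map E map_polyZ hornerZ rmorph_prod horner_prod.
rewrite (addrC lambda) => H; rewrite (pairing_shift char0) ?size_prod_XsubC // add0r.
apply: (mulfI (expf_neq0 n s0)); rewrite -[LHS]H !mulrA -exprD zIJ.
rewrite exprD -!mulrA; congr (_ * _); rewrite mulrCA; congr (_ * _).
rewrite -(prod_const_seq g) -big_split; apply: eq_bigr => x _ /=.
by rewrite rmorphB /= map_polyX map_polyC hornerXsubC /=; field.
Qed.

(** In the application sigma is a linear form, not invertible, so the identity is proved in the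
    fraction field. *)
Lemma pairing_homog_idomain (A : idomainType) (f : {rmorphism R -> A}) n (I J g : seq R) C
    (sigma rho lambda mu : A) : sigma != 0 ->
  (size I <= n)%N -> (size J <= n)%N -> (size I + size J = n + size g)%N ->
  conv n (\prod_(x <- I) ('X - x%:P)) (\prod_(x <- J) ('X - x%:P)) =
    C *: \prod_(x <- g) ('X - x%:P) ->
  pairing n (\prod_(x <- I) ('X - (f x * sigma + lambda)%:P))
            (\prod_(x <- J) ('X - (f x * sigma + mu)%:P)) (rho + lambda + mu) 0 =
  f C * \prod_(x <- g) (rho - f x * sigma).
Proof.
move=> s0 zI zJ zIJ E; apply/eqP; rewrite -tofrac_eq; apply/eqP.
pose tf : {rmorphism A -> {fraction A}} := @tofrac A.
have Ep (S : seq R) nu : map_poly tf (\prod_(x <- S) ('X - (f x * sigma + nu)%:P)) =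
    \prod_(x <- S) ('X - ((tf \o f) x * tf sigma + tf nu)%:P).
  rewrite rmorph_prod; apply: eq_bigr => x _.
  by rewrite rmorphB /= map_polyX map_polyC /= rmorphD rmorphM.
rewrite -[LHS]/(tf _) -[RHS]/(tf _) pairing_map !Ep !rmorphD rmorph0.
rewrite (@pairing_homog _ (tf \o f) _ _ _ g C) ?tofrac_eq0 //.
rewrite rmorphM rmorph_prod; congr (_ * _); apply: eq_bigr => x _.
by rewrite rmorphB rmorphM.
Qed.
End LowestTerm.

Section CurveLocal.
Variables (R : realType) (n : nat) (alpha beta : 'rV[R]_n).
Implicit Types (w : 'rV[R]_(n + n)).

Let charR0 : [pchar R] =i pred0 := @pchar_num R.

(** Along p + s d the clusters I and J contribute s^(n + r), of which scaling absorbs s^n. At s = 0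
    the roots outside the clusters only leave the nonzero constant k. Directions with entries in A
    cover real lines as well as the generic chart direction. *)
Lemma curve_local (A : idomainType) (f : {rmorphism R -> A}) w (p : 'I_3 -> R)
    (d : 'I_3 -> A) a b r :
  let lin (rho u : 'rV[R]_n) i := f (rho 0 i) * d iy + f (u 0 i) * d it in
  let I := rootset (fiber_root alpha (lsubmx w) (p iy) (p it)) a in
  let J := rootset (fiber_root beta (rsubmx w) (p iy) (p it)) b in
  a + b = p ix -> (#|I| + #|J| = n + r)%N ->
  exists K : {poly A}, exists2 k : R, k != 0 &
    mmap (polyC \o f) (fun j => (f (p j))%:P + 'X * (d j)%:P) (curve alpha beta w) = 'X^r * K /\
    K.[0] = f k * pairing n (\prod_(i in I) ('X - (lin alpha (lsubmx w) i)%:P))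
                            (\prod_(i in J) ('X - (lin beta (rsubmx w) i)%:P)) (d ix) 0.
Proof.
move=> lin I J ab cIJ.
have char0 : [pchar A] =i pred0.
  apply/pcharf0P => m; rewrite -(rmorph_nat f).
  have [->|m0] := eqVneq m 0%N; first by rewrite rmorph0 eqxx.
  apply/negbTE/negP => /eqP fm0; have : f (m%:R^-1 * m%:R) = 0 by rewrite rmorphM fm0 mulr0.
  by rewrite mulVf ?((pcharf0P R).1 charR0) // rmorph1 => /eqP; rewrite oner_eq0.
have Efac (rho u : 'rV[R]_n) :
    \prod_(i < n) ('X - ((f (rho 0 i))%:P * ((f (p iy))%:P + 'X * (d iy)%:P) +
      (f (u 0 i))%:P * ((f (p it))%:P + 'X * (d it)%:P))%:P) =
    \prod_(i < n) ('X - ((f (fiber_root rho u (p iy) (p it) i))%:P + 'X * (lin rho u i)%:P)%:P).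
  apply: eq_bigr => i _; congr ('X - _%:P).
  by rewrite /lin /fiber_root !rmorphD !rmorphM /=; ring.
rewrite mmap_curve /=.
have [P1 [k1 k10 [EP EP0]]] := prod_XsubC_local f
  (fiber_root alpha (lsubmx w) (p iy) (p it)) (lin alpha (lsubmx w)) a.
have [Q1 [k2 k20 [EQ EQ0]]] := prod_XsubC_local f
  (fiber_root beta (rsubmx w) (p iy) (p it)) (lin beta (rsubmx w)) b.
exists ((f n`!%:R^-1)%:P * pairing n P1 Q1 (d ix)%:P 0), (n`!%:R^-1 * (k1 * k2)).
  by rewrite !mulf_neq0 // invr_eq0 ((pcharf0P R).1 charR0) -lt0n fact_gt0.
split; last first.
  rewrite hornerM hornerC pairing_horner0 EP0 EQ0 pairingZl pairingZr hornerC !rmorphM !mulrA.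
  by [].
rewrite mulrCA; congr (_ * _).
rewrite -(@pairing_local _ n r #|I| #|J| _ _ P1 Q1 (f a)%:P (f b)%:P (d ix)%:P cIJ EP EQ).
rewrite -ab rmorphD polyCD addrAC (pairing_shift (pchar_poly0 char0)) ?size_prod_XsubC_ord // add0r.
by rewrite !Efac.
Qed.
End CurveLocal.

(** * Singular points, their fibers and their tangents *)

Section Singularities.
Variables (R : realType) (n : nat) (alpha beta : 'rV[R]_n).
Hypotheses (halpha : injective (alpha 0)) (hbeta : injective (beta 0)).
Implicit Types (w : 'rV[R]_(n + n)) (p : 'rV[R]_3) (rho u : 'rV[R]_n).

Let charR0 : [pchar R] =i pred0 := @pchar_num R.

Local Notation mult := (fiber_mult alpha beta).
Local Notation fconv := (fiber_conv alpha beta).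

Lemma ord3P (j : 'I_3) : [\/ j = ix, j = iy | j = it].
Proof.
by case: j => [[|[|[|//]]] h]; [apply: Or31|apply: Or32|apply: Or33]; apply: val_inj.
Qed.

Let fact_inv_neq0 : n`!%:R^-1 != 0 :> R.
Proof. by rewrite invr_eq0 ((pcharf0P R).1 charR0) -lt0n fact_gt0. Qed.

Lemma slice_curve w y t : slice (curve alpha beta w) y t = n`!%:R^-1 *: fconv w y t.
Proof.
rewrite /slice; transitivity (mmap (@polyC R)
    (fun j => if j == ix then 'X else if j == iy then y%:P else t%:P) (curve alpha beta w)).
  by apply: mmap_ext => // j; case: (ord3P j) => ->.
by rewrite slice_line comp_polyXr.
Qed.

Lemma mup_slice w y t x : mup x (slice (curve alpha beta w) y t) = mup x (fconv w y t).
Proof. by rewrite slice_curve -mul_polyC mupMr // rootC. Qed.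

Lemma curve_meval w (p : 'I_3 -> R) :
  (curve alpha beta w).@[p] = n`!%:R^-1 * (fconv w (p iy) (p it)).[p ix] /\
  ((curve alpha beta w)^`M(ix)).@[p] = n`!%:R^-1 * (fconv w (p iy) (p it))^`().[p ix].
Proof.
have [] := meval_line p (fun j => (j == ix)%:R) (curve alpha beta w).
have -> : mmap (@polyC R) (fun j => (p j)%:P + 'X * ((j == ix)%:R)%:P) (curve alpha beta w) =
    n`!%:R^-1 *: (fconv w (p iy) (p it) \Po ((p ix)%:P + 1 *: 'X)).
  rewrite -slice_line; apply: mmap_ext => // j.
  by case: (ord3P j) => -> /=; rewrite ?mulr1 ?mulr0 ?addr0 ?scale1r.
rewrite (bigD1 ix) //= big1 ?addr0 => [|j /negPf ->]; last by rewrite mul0r.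
have := derivn_comp_affine (fconv w (p iy) (p it)) (p ix) 1 1.
rewrite !derivn1 expr1 scale1r derivZ => ->.
by rewrite !scale1r mul1r !hornerZ !horner_comp hornerD hornerC hornerX addr0 => <- <-.
Qed.

Lemma card_rootset_le rho u y t a : (#|rootset (fiber_root rho u y t) a| <= n)%N.
Proof. by rewrite (leq_trans (max_card _)) // card_ord. Qed.

Lemma fiber_mult_ge2 w y t a b : (n + 2 <= mult w y t a b)%N ->
  (2 <= #|rootset (fiber_root alpha (lsubmx w) y t) a|)%N /\
  (2 <= #|rootset (fiber_root beta (rsubmx w) y t) b|)%N.
Proof.
have := card_rootset_le alpha (lsubmx w) y t a; have := card_rootset_le beta (rsubmx w) y t b.
by rewrite /fiber_mult; lia.
Qed.

(** Over t = 0 the roots are y times the distinct coordinates of alpha, so no cluster of two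
    exists. *)
Lemma fiber_mult_t_neq0 w y t a b : (y, t) != (0, 0) -> (n + 2 <= mult w y t a b)%N -> t != 0.
Proof.
move=> yt /fiber_mult_ge2 [h _]; apply: contraNneq yt => t0; rewrite t0 in h *.
rewrite xpair_eqE eqxx andbT; apply: contraTT h => y0; rewrite -ltnNge ltnS.
apply/card_le1_eqP => i j; rewrite !inE /fiber_root !mulr0 !addr0 => /eqP <- /eqP.
by move/(mulIf y0)/halpha.
Qed.

Lemma singular_double w p : singular_point (curve alpha beta w) p ->
  (2 <= mup (p 0%R ix) (fconv w (p 0%R iy) (p 0%R it)))%N /\ p 0 it != 0.
Proof.
case=> p0 hp dp; have [e0 e1] := curve_meval w (p 0).
have dbl : (2 <= mup (p 0%R ix) (fconv w (p 0%R iy) (p 0%R it)))%N.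
  rewrite mup_ge2 ?fiber_conv_neq0 //; move/eqP: e0; rewrite hp eq_sym mulf_eq0 (negPf fact_inv_neq0).
  move=> /= r0; apply/andP; split=> //; move/eqP: e1; rewrite dp eq_sym mulf_eq0.
  by rewrite (negPf fact_inv_neq0).
split=> //; have [a [b [ab hm]]] := fiber_conv_double dbl.
have hm2 : (n + 2 <= mult w (p 0%R iy) (p 0%R it) a b)%N by rewrite hm leq_add2l.
(* The center [1 : 0 : 0] is excluded: if y = t = 0, all fiber roots are 0, so a = b = 0 and x = 0
   too. *)
apply: (fiber_mult_t_neq0 _ hm2); apply: contra_neq p0 => -[y0 t0].
have [] := fiber_mult_ge2 hm2; rewrite y0 t0 => /ltnW; rewrite card_gt0 => /set0Pn [k].
rewrite inE /fiber_root !mulr0 addr0 => /eqP a0 /ltnW.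
rewrite card_gt0 => /set0Pn [j].
rewrite inE /fiber_root !mulr0 addr0 => /eqP b0; apply/rowP => m; rewrite mxE.
by case: (ord3P m) => ->; rewrite // -ab -a0 -b0 addr0.
Qed.

(** Along every line through p the equation is divisible by s^r with r >= 2, so its value and all
    first derivatives vanish. *)
Lemma double_singular w p : p != 0 ->
  (2 <= mup (p 0%R ix) (fconv w (p 0%R iy) (p 0%R it)))%N -> singular_point (curve alpha beta w) p.
Proof.
move=> p0 dbl; have [a [b [ab hm]]] := fiber_conv_double dbl.
move: dbl hm; move: (mup _ _) => r r2 hm.
have loc (d : 'I_3 -> R) : exists K, mmap (@polyC R) (fun j => (p 0 j)%:P + 'X * (d j)%:P)
    (curve alpha beta w) = 'X^r * K.
  have [K [k _ [EK _]]] := @curve_local R n alpha beta R idfun w (p 0) d a b r ab hm.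
  by exists K.
split=> // [|i].
  have [K EK] := loc (fun _ => 0).
  have [<- _] := meval_line (p 0) (fun _ => 0) (curve alpha beta w).
  by rewrite EK hornerM hornerXn expr0n (gtn_eqF (ltnW r2)) mul0r.
have [K EK] := loc (fun j => (j == i)%:R).
have [_] := meval_line (p 0) (fun j => (j == i)%:R) (curve alpha beta w).
rewrite (bigD1 i) //= big1 ?addr0 => [|j /negPf ->]; last by rewrite mul0r.
rewrite eqxx mul1r => <-; rewrite EK.
by rewrite horner_coef0 coef_deriv coefXnM r2 mul0rn.
Qed.

(** Two indices clustered over two different parameters would have equal coordinates of alpha (or
    beta), so clusters over different fibers share at most one index on each side. Their sizes then
    total at most 2n + 2, against 2n + r + s >= 2n + 4. *)
Lemma singular_same_fiber w p q : singular_point (curve alpha beta w) p ->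
  singular_point (curve alpha beta w) q -> p 0 iy * q 0 it = q 0 iy * p 0 it.
Proof.
move=> /singular_double [dp tp] /singular_double [dq tq].
have [a [b [_ hp]]] := fiber_conv_double dp; have [a' [b' [_ hq]]] := fiber_conv_double dq.
move: (mup _ _) dp hp => r r2 hp; move: (mup _ _) dq hq => s s2 hq.
apply/eqP/negPn/negP => ne.
have small rho u c c' : injective (rho 0) ->
    (#|rootset (fiber_root rho u (p 0%R iy) (p 0%R it)) c :&:
       rootset (fiber_root rho u (q 0%R iy) (q 0%R it)) c'| <= 1)%N.
  move=> inj; apply/card_le1_eqP => i j.
  rewrite !inE /fiber_root => /andP[/eqP i1 /eqP i2] /andP[/eqP j1 /eqP j2].
  apply: inj; apply/eqP.
  have : (rho 0 i - rho 0 j) * (p 0 iy * q 0 it - q 0 iy * p 0 it) = 0.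
    transitivity ((rho 0 i * p 0 iy + u 0 i * p 0 it - (rho 0 j * p 0 iy + u 0 j * p 0 it)) * q 0 it
      - (rho 0 i * q 0 iy + u 0 i * q 0 it - (rho 0 j * q 0 iy + u 0 j * q 0 it)) * p 0 it).
      by ring.
    by rewrite i1 i2 j1 j2 !subrr !mul0r subrr.
  by move/eqP; rewrite mulf_eq0 !subr_eq0 (negPf ne) orbF eq_sym.
have big (S T : {set 'I_n}) : (#|S| + #|T| <= n + #|S :&: T|)%N.
  by rewrite -cardsUI leq_add2r (leq_trans (max_card _)) // card_ord.
have := small alpha (lsubmx w) a a' halpha; have := small beta (rsubmx w) b b' hbeta.
move: hp hq; rewrite /fiber_mult.
set I := rootset _ a; set J := rootset _ b; set I' := rootset _ a'; set J' := rootset _ b'.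
have no (x y x' y' c d : nat) : (x + x' <= n + c)%N -> (y + y' <= n + d)%N ->
    (x + y)%N = (n + r)%N -> (x' + y')%N = (n + s)%N -> (d <= 1)%N -> (c <= 1)%N -> False.
  by lia.
exact: no (big I I') (big J J').
Qed.

(** A linear form that vanishes at p and on the plane of chart directions is zero, since p_i != 0
    puts p outside that plane. *)
Lemma chart_dir_indep (p : 'I_3 -> R) i (e : 'I_3 -> R) : p i != 0 ->
  \sum_j e j * p j = 0 -> \sum_j (e j)%:MP_[2] * chart_dir R i j = 0 -> forall j, e j = 0.
Proof.
move=> pi0 ep ec j.
(* The projection along p of the j-th basis vector to the plane where coordinate i is 0. *)
pose d k := (k == j)%:R - (i == j)%:R / p i * p k.
have ev k : (chart_dir R i k).@[fun l => d (lift i l)] = d k.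
  rewrite /chart_dir; case: unliftP => [l ->|->]; first by rewrite mevalXU.
  by rewrite meval0 /d divfK // subrr.
have := congr1 (meval (fun l => d (lift i l))) ec.
rewrite meval0 raddf_sum /=; under eq_bigr => k _ do rewrite mevalM mevalC ev /d mulrBr.
rewrite sumrB [X in _ - X](_ : _ = (i == j)%:R / p i * \sum_k e k * p k); last first.
  by rewrite mulr_sumr; apply: eq_bigr => k _; ring.
rewrite ep mulr0 subr0 (bigD1 j) //= eqxx mulr1 big1 ?addr0 // => k /negPf ->.
by rewrite mulr0.
Qed.

Lemma sum_ord3 (V : nmodType) (F : 'I_3 -> V) : \sum_j F j = F ix + F iy + F it.
Proof.
rewrite !big_ord_recl big_ord0 addr0 addrA; congr (F _ + F _ + F _); exact: val_inj.
Qed.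

Lemma chart_dir_homog i j : chart_dir R i j \is 1.-homog.
Proof.
rewrite /chart_dir; case: unlift => [k|]; last exact: rpred0.
by rewrite dhomogX; apply/eqP; exact: mdeg1.
Qed.

Lemma singular_ordinary w p : singular_point (curve alpha beta w) p ->
  exists r : nat, (2 <= r)%N /\ ordinary_point (curve alpha beta w) p r.
Proof.
move=> /singular_double [dbl t0]; have [a [b [ab hm]]] := fiber_conv_double dbl.
move: dbl hm; move: (mup _ _) => r r2 hm; exists r; split=> // i pi0.
pose I := rootset (fiber_root alpha (lsubmx w) (p 0 iy) (p 0 it)) a.
pose J := rootset (fiber_root beta (rsubmx w) (p 0 iy) (p 0 it)) b.
have scale rho u c : rootset (fiber_root rho u (p 0 iy / p 0 i) (p 0 it / p 0 i)) (c / p 0 i) =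
    rootset (fiber_root rho u (p 0 iy) (p 0 it)) c.
  apply/setP => k; rewrite !inE /fiber_root !mulrA -mulrDl; apply/eqP/eqP => [|->] //.
  by apply: mulIf; rewrite invr_eq0.
have hab : a / p 0 i + b / p 0 i = p 0 ix / p 0 i by rewrite -mulrDl ab.
have [|K [k k0 [EK K0]]] := @curve_local R n alpha beta _ (@mpolyC 2 R) w
  (fun j => p 0 j / p 0 i) (chart_dir R i) _ _ r hab; first by rewrite !scale.
rewrite !scale -/I -/J in K0.
have sz (S : {set 'I_n}) (rho : 'rV[R]_n) : size [seq rho 0 k | k <- enum S] = #|S|.
  by rewrite size_map cardE.
have un (S : {set 'I_n}) (rho : 'rV[R]_n) : injective (rho 0) -> uniq [seq rho 0 k | k <- enum S].
  by move=> inj; rewrite map_inj_uniq ?enum_uniq.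
have [||||c [g [c0 ug zg Eg]]] := @conv_simple_roots R n r
  [seq alpha 0 k | k <- enum I] [seq beta 0 k | k <- enum J] (un _ _ halpha) (un _ _ hbeta).
- by rewrite sz card_rootset_le.
- by rewrite sz card_rootset_le.
- by rewrite !sz.
- by rewrite ltnW.
(* [sigma] and [rho] come from independent linear forms vanishing at p. On a cluster, eliminating u
   through y alpha + t u = a rewrites each line as alpha_m [sigma] plus a term common to the
   cluster. *)
pose X := chart_dir R i; pose y' := p 0 iy / p 0 it; pose x' := p 0 ix / p 0 it.
pose sigma := X iy - y'%:MP_[2] * X it; pose rho := X ix - x'%:MP_[2] * X it.
pose lam s := (s / p 0 it)%:MP_[2] * X it.
have Elin (gam u : 'rV[R]_n) s : \prod_(k in rootset (fiber_root gam u (p 0 iy) (p 0 it)) s)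
      ('X - ((gam 0 k)%:MP_[2] * X iy + (u 0 k)%:MP_[2] * X it)%:P) =
    \prod_(x <- [seq gam 0 k | k <- enum (rootset (fiber_root gam u (p 0 iy) (p 0 it)) s)])
      ('X - (x%:MP_[2] * sigma + lam s)%:P).
  rewrite big_map big_enum; apply: eq_bigr => m; rewrite inE /fiber_root => /eqP e.
  congr ('X - _%:P); rewrite /sigma /lam.
  have -> : u 0 m = s / p 0 it - gam 0 m * y' by rewrite -e /y'; field.
  by rewrite mpolyCB mpolyCM; ring.
have combo (e1 e2 : R) : e1%:MP_[2] * rho + e2%:MP_[2] * sigma = 0 -> e1 = 0 /\ e2 = 0.
  pose e j := if j == ix then e1 else if j == iy then e2 else - (e1 * x' + e2 * y').
  move=> h; have := @chart_dir_indep (p 0) i e pi0; rewrite !sum_ord3 /e /= => H.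
  have {}H := H _ _; have hh : forall j, e j = 0.
    apply: H; first by rewrite /x' /y'; field.
    by rewrite -h /rho /sigma mpolyCN mpolyCD !mpolyCM /X; ring.
  by have := hh ix; have := hh iy.
have sigma0 : sigma != 0.
  apply/eqP => s0; have [|_ /eqP] := combo 0 1; first by rewrite s0 mpolyC0 mul0r mulr0 addr0.
  by rewrite oner_eq0.
have hX : X ix = rho + lam a + lam b.
  by rewrite /rho /lam /x' -ab mulrDl mpolyCD; ring.
have {}K0 : K.[0] = (k * c)%:MP_[2] * \prod_(x <- g) (rho - x%:MP_[2] * sigma).
  rewrite K0 /I /J !Elin -/X hX.
  rewrite (@pairing_homog_idomain R _ (@mpolyC 2 R) n _ _ g c sigma rho) ?sz ?card_rootset_le ?zg //.
  by rewrite mpolyCM mulrA.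
have kc0 : k * c != 0 by rewrite mulf_neq0.
have r0 : (0 < r)%N by rewrite ltnW.
(* The lowest term must equal the product exactly, so the first factor carries the constant. *)
pose C (j : 'I_r) : R := if j == Ordinal r0 then k * c else 1.
have C0 j : C j != 0 by rewrite /C; case: ifP; rewrite ?oner_neq0.
pose l (j : 'I_r) : {mpoly R[2]} := C j *: (rho - (g`_j)%:MP_[2] * sigma).
have hom : forall j, l j \is 1.-homog.
  move=> j; rewrite rpredZ // rpredB // /rho /sigma !mul_mpolyC ?rpredZ // ?rpredB // ?rpredZ //;
  exact: chart_dir_homog.
have indep : forall j j', j != j' -> forall s : R, l j != s *: l j'.
  move=> j j' jj' s; apply: contra_neq jj' => E; apply/val_inj/eqP.
  rewrite -(nth_uniq 0 _ _ ug) ?zg ?ltn_ord //.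
  have [|e1 e2] := combo (C j - s * C j') (- (C j * g`_j - s * C j' * g`_j')).
    have := E; rewrite /l => /eqP; rewrite -subr_eq0 => /eqP <-.
    by rewrite -!mul_mpolyC mpolyCN !mpolyCB !mpolyCM; ring.
  move/eqP: e2; rewrite oppr_eq0; move/eqP: e1; rewrite subr_eq0 => /eqP <-.
  by rewrite -mulrBr mulf_eq0 (negPf (C0 j)) subr_eq0.
have prodl : \prod_j l j = K.[0].
  rewrite /l scaler_prod K0 mul_mpolyC; congr (_ *: _).
    by rewrite (bigD1 (Ordinal r0)) //= /C eqxx big1 ?mulr1 // => j /negPf ->.
  by rewrite (big_nth 0) big_mkord zg.
have hc d : hcomp d (local_eq (curve alpha beta w) p i) = ('X^r * K)`_d.
  by rewrite -hcomp_coef local_eq_scale // -EK.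
exists l; split=> //; split.
- by rewrite hc coefXnM ltnn subnn -horner_coef0.
(* Nonproportionality with scalar 0 against any other index, available because r >= 2, shows that
   each factor is nonzero. *)
- apply/prodf_neq0 => j _; pose j' : 'I_r := if j == Ordinal r0 then Ordinal r2 else Ordinal r0.
  have jj' : j != j' by rewrite /j'; case: (eqVneq j (Ordinal r0)) => [->|].
  by have := indep _ _ jj' 0; rewrite scale0r.
- by move=> d dr; rewrite hc coefXnM dr.
Qed.
End Singularities.

(** * The subspaces L + R^S *)

Section LinearAlgebra.
Variables (R : realType) (n : nat) (alpha beta : 'rV[R]_n).
Hypotheses (hn : (2 <= n)%N) (halpha : injective (alpha 0)) (hbeta : injective (beta 0)).
Implicit Types (w v : 'rV[R]_(n + n)) (S : {set 'I_(n + n)}).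

Lemma exists_superset_card (T : finType) (A : {set T}) m : (#|A| <= m <= #|T|)%N ->
  exists2 B : {set T}, A \subset B & #|B| = m.
Proof.
move=> /andP[]; elim: m => [|m IH] hA hT.
  by exists A => //; apply/eqP; rewrite -leqn0.
move: hA; rewrite leq_eqVlt => /orP[/eqP <-|hA]; first by exists A.
have [B AB cB] := IH hA (ltnW hT).
have : (0 < #|~: B|)%N by rewrite cardsCs setCK subn_gt0 cB.
rewrite card_gt0 => /set0Pn [x]; rewrite inE => xB.
exists (x |: B); first by rewrite (subset_trans AB) // subsetUr.
by rewrite cardsU1 xB cB.
Qed.

Lemma card_split_ord S :
  #|S| = (#|[set i | lshift n i \in S]| + #|[set i | rshift n i \in S]|)%N.
Proof.
rewrite -!sum1_card big_mkcond big_split_ord /= -!big_mkcond /=.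
by congr (_ + _)%N; apply: eq_bigl => i; rewrite inE.
Qed.

Lemma mem_coord_space v S :
  v \in coord_space R S <-> forall j, j \notin S -> v 0 j = 0.
Proof.
split=> [vS j jS|h].
  rewrite (coord_span (X := in_tuple _) vS) summxE big1 // => i _.
  have : [seq delta_mx 0 k | k <- enum S]`_i \in [seq (delta_mx 0 k : 'rV[R]_(n + n)) | k <- enum S].
    by rewrite mem_nth.
  case/mapP => k; rewrite mem_enum => kS ->; rewrite !mxE eqxx /=.
  by case: eqP => [jk|_]; rewrite ?mulr0 //; rewrite jk kS in jS.
rewrite [v]row_sum_delta; apply: memv_suml => j _.
have [jS|/h ->] := boolP (j \in S); last by rewrite scale0r mem0v.
by apply/memvZ/memv_span/map_f; rewrite mem_enum.
Qed.

Lemma mem_Lspace v : v \in Lspace alpha beta <-> exists c1 c2 c3,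
  (forall i, v 0 (lshift n i) = c1 + c3 * alpha 0 i) /\
  (forall i, v 0 (rshift n i) = c2 + c3 * beta 0 i).
Proof.
rewrite /Lspace !span_cons span_nil addv0; split.
  case/memv_addP => _ /vlineP [c1 ->] [_ /memv_addP [_ /vlineP [c2 ->] [_ /vlineP [c3 ->] ->]] ->].
  exists (c1 - c3 * mean alpha), (c2 - c3 * mean beta), c3.
  by split=> i; rewrite !(row_mxEl, row_mxEr, mxE); ring.
case=> c1 [c2 [c3 [h1 h2]]].
have -> : v = (c1 + c3 * mean alpha) *: row_mx (const_mx 1) 0 +
    ((c2 + c3 * mean beta) *: row_mx 0 (const_mx 1) +
     c3 *: row_mx (centered alpha) (centered beta)).
  apply/rowP => k; rewrite -(splitK k); case: (split k) => i /=.
    by rewrite h1 !(row_mxEl, row_mxEr, mxE); ring.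
  by rewrite h2 !(row_mxEl, row_mxEr, mxE); ring.
by rewrite !memv_add // memvZ // memv_line.
Qed.

Lemma mem_stratum w S : w \in (Lspace alpha beta + coord_space R S)%VS <->
  exists c1 c2 c3,
    (forall i, lshift n i \notin S -> w 0 (lshift n i) = c1 + c3 * alpha 0 i) /\
    (forall i, rshift n i \notin S -> w 0 (rshift n i) = c2 + c3 * beta 0 i).
Proof.
split=> [/memv_addP [u /mem_Lspace [c1 [c2 [c3 [h1 h2]]]] [v /mem_coord_space hv ->]]|].
  by exists c1, c2, c3; split=> i iS; rewrite mxE hv // addr0 ?h1 ?h2.
case=> c1 [c2 [c3 [h1 h2]]].
pose u : 'rV[R]_(n + n) := row_mx (\row_i (c1 + c3 * alpha 0 i)) (\row_i (c2 + c3 * beta 0 i)).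
rewrite -(subrK u w) addrC memv_add //.
  by apply/mem_Lspace; exists c1, c2, c3; split=> i; rewrite ?row_mxEl ?row_mxEr mxE.
apply/mem_coord_space => k; rewrite -(splitK k); case: (split k) => i /= iS.
  by rewrite mxE h1 // mxE row_mxEl mxE subrr.
by rewrite mxE h2 // mxE row_mxEr mxE subrr.
Qed.

Lemma affine_vanish (m : nat) (rho : 'rV[R]_m) (A : {set 'I_m}) c d : injective (rho 0) ->
  (forall i, i \in A -> c + d * rho 0 i = 0) -> (2 <= #|A|)%N -> d = 0.
Proof.
move=> inj h A2; apply/eqP/negPn/negP => d0.
have : (#|A| <= 1)%N.
  apply/card_le1_eqP => i j /h hi /h hj; apply/inj/(mulfI d0)/(addrI c).
  by rewrite hi hj.
by rewrite leqNgt A2.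
Qed.

(** At least n + 1 of the 2n coordinates lie outside S. Each block therefore contains one of them
    and some block contains two; distinct coordinates there force the common slope c3 to vanish, and
    then both constants. *)
Lemma Lspace_support S c1 c2 c3 : (#|S| < n)%N ->
  (forall i, lshift n i \notin S -> c1 + c3 * alpha 0 i = 0) ->
  (forall i, rshift n i \notin S -> c2 + c3 * beta 0 i = 0) -> [/\ c1 = 0, c2 = 0 & c3 = 0].
Proof.
move=> cS h1 h2.
pose A := ~: [set i | lshift n i \in S]; pose B := ~: [set i | rshift n i \in S].
have cA : (#|A| + #|[set i | lshift n i \in S]| = n)%N.
  by rewrite addnC cardsC card_ord.
have cB : (#|B| + #|[set i | rshift n i \in S]| = n)%N.
  by rewrite addnC cardsC card_ord.
have cs := card_split_ord S.
have A1 : (0 < #|A|)%N by lia.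
have B1 : (0 < #|B|)%N by lia.
have hA i : i \in A -> c1 + c3 * alpha 0 i = 0 by rewrite !inE; apply: h1.
have hB i : i \in B -> c2 + c3 * beta 0 i = 0 by rewrite !inE; apply: h2.
have c30 : c3 = 0.
  have [A2|A2] := leqP 2 #|A|; first exact: affine_vanish halpha hA A2.
  have B2 : (2 <= #|B|)%N by lia.
  exact: affine_vanish hbeta hB B2.
move: A1 B1; rewrite !card_gt0 => /set0Pn [k /hA] + /set0Pn [l /hB].
by rewrite c30 !mul0r !addr0.
Qed.

Lemma dim_coord_space S : \dim (coord_space R S) = #|S|.
Proof.
have le (T : {set 'I_(n + n)}) : (\dim (coord_space R T) <= #|T|)%N.
  by rewrite (leq_trans (dim_span _)) // size_map -cardE.
have full : (fullv <= coord_space R S + coord_space R (~: S))%VS.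
  apply/subvP => v _; rewrite [v]row_sum_delta; apply: memv_suml => j _; apply: memvZ.
  have [jS|jS] := boolP (j \in S); [rewrite -[delta_mx _ _]addr0|rewrite -[delta_mx _ _]add0r];
    rewrite memv_add ?mem0v //; apply/mem_coord_space => k kS; rewrite mxE eqxx /=;
    case: eqP => // kj; move: kS; rewrite kj ?inE ?jS //.
have := leq_trans (dimvS full) (dimv_add_leqif _ _).1.
rewrite dimvf dim_matrix mul1r => h.
have := cardsC S; rewrite card_ord => cC.
by have := le S; have := le (~: S); lia.
Qed.

Lemma dim_Lspace : \dim (Lspace alpha beta) = 3%N.
Proof.
suff : free [tuple (row_mx (const_mx 1) 0 : 'rV[R]_(n + n)); row_mx 0 (const_mx 1);
    row_mx (centered alpha) (centered beta)] by move/eqP.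
apply/freeP => k; rewrite !big_ord_recl big_ord0 addr0 /=.
set k0 := k _; set k1 := k _; set k2 := k _ => h.
have hl i : k0 - k2 * mean alpha + k2 * alpha 0 i = 0.
  have := congr1 (fun v : 'rV[R]_(n + n) => v 0 (lshift n i)) h.
  by rewrite !(row_mxEl, row_mxEr, mxE) => <-; ring.
have hr i : k1 - k2 * mean beta + k2 * beta 0 i = 0.
  have := congr1 (fun v : 'rV[R]_(n + n) => v 0 (rshift n i)) h.
  by rewrite !(row_mxEl, row_mxEr, mxE) => <-; ring.
have [|||e0 e1 e2] := @Lspace_support set0 (k0 - k2 * mean alpha) (k1 - k2 * mean beta) k2.
- by rewrite cards0 ltnW.
- by move=> i _; exact: hl.
- by move=> i _; exact: hr.
move: e0 e1; rewrite e2 !mul0r !subr0 => e0 e1.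
case=> [[|[|[|//]]] hi]; [rewrite -e0|rewrite -e1|rewrite -e2];
  by congr k; apply: val_inj.
Qed.

Lemma dim_stratum S : (#|S| < n)%N ->
  \dim (Lspace alpha beta + coord_space R S)%VS = (#|S| + 3)%N.
Proof.
move=> cS; suff cap : (Lspace alpha beta :&: coord_space R S)%VS = 0%VS.
  by rewrite (dimv_disjoint_sum cap) dim_Lspace dim_coord_space addnC.
apply/eqP; rewrite -subv0; apply/subvP => v; rewrite memv_cap => /andP[].
move=> /mem_Lspace [c1 [c2 [c3 [h1 h2]]]] /mem_coord_space hS.
have [i iS|i iS|e1 e2 e3] := @Lspace_support S c1 c2 c3 cS.
- by rewrite -h1 hS.
- by rewrite -h2 hS.
rewrite memv0; apply/eqP/rowP => k; rewrite -(splitK k) mxE; case: (split k) => i /=.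
  by rewrite h1 e1 e3 mul0r addr0.
by rewrite h2 e2 e3 mul0r addr0.
Qed.

(** For j in T but not in S, the basis vector at j is an element of L plus a vector of R^S. That
    element of L is supported on S and j, fewer than n places, so it is 0, which contradicts the
    entry 1 at j. *)
Lemma stratum_inj S (T : {set 'I_(n + n)}) : (#|S|.+1 < n)%N -> #|S| = #|T| ->
  (Lspace alpha beta + coord_space R S = Lspace alpha beta + coord_space R T)%VS -> S = T.
Proof.
move=> cS cST E; apply/eqP; rewrite eq_sym eqEcard cST leqnn andbT.
apply/subsetP => j jT; apply/negPn/negP => jS.
have : (delta_mx 0 j : 'rV[R]_(n + n)) \in (Lspace alpha beta + coord_space R S)%VS.
  rewrite E -[delta_mx _ _]add0r memv_add ?mem0v //.
  by apply/memv_span/map_f; rewrite mem_enum.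
move=> /mem_stratum [c1 [c2 [c3 [h1 h2]]]].
have [|i|i|e1 e2 e3] := @Lspace_support (j |: S) c1 c2 c3.
- by rewrite cardsU1 jS.
- rewrite !inE negb_or => /andP[ij iS].
  by rewrite -h1 // mxE (negPf ij) andbF.
- rewrite !inE negb_or => /andP[ij iS].
  by rewrite -h2 // mxE (negPf ij) andbF.
move: h1 h2 jS; rewrite -(splitK j); case: (split j) => i /= h1 h2 jS.
  by have /eqP := h1 _ jS; rewrite mxE !eqxx e1 e3 mul0r addr0 oner_eq0.
by have /eqP := h2 _ jS; rewrite mxE !eqxx e2 e3 mul0r addr0 oner_eq0.
Qed.

Lemma uniq_strata m : (m.+1 < n)%N -> uniq (strata alpha beta m).
Proof.
move=> mn; rewrite map_inj_in_uniq ?enum_uniq // => S T.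
rewrite !mem_enum !inE => /eqP cS /eqP cT; apply: stratum_inj; first by rewrite cS.
by rewrite cS cT.
Qed.

Lemma size_strata m : size (strata alpha beta m) = 'C(2 * n, m).
Proof. by rewrite size_map -cardE card_draws card_ord mul2n addnn. Qed.

Lemma Sigma_stratum r w : (2 <= r <= n)%N ->
  Sigma alpha beta r w <->
  exists S, #|S| = (n - r)%N /\ w \in (Lspace alpha beta + coord_space R S)%VS.
Proof.
move=> /andP[r2 rn]; split.
  case=> y [t [yt [x]]]; rewrite mup_slice => h.
  have [a [b [ab hm]]] := fiber_conv_double (leq_trans r2 h).
  have {h}{}hm : (n + r <= fiber_mult alpha beta w y t a b)%N by rewrite hm leq_add2l.
  have t0 : t != 0.
    have hm2 : (n + 2 <= fiber_mult alpha beta w y t a b)%N by rewrite (leq_trans _ hm) // leq_add2l.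
    by apply: fiber_mult_t_neq0 yt hm2.
  pose I := rootset (fiber_root alpha (lsubmx w) y t) a.
  pose J := rootset (fiber_root beta (rsubmx w) y t) b.
  pose S0 : {set 'I_(n + n)} :=
    [set k | match split k with inl i => i \notin I | inr j => j \notin J end].
  have lS i : (lshift n i \in S0) = (i \notin I) by rewrite inE (unsplitK (inl i)).
  have rS i : (rshift n i \in S0) = (i \notin J) by rewrite inE (unsplitK (inr i)).
  have cS0 : (#|S0| <= n - r)%N.
    rewrite card_split_ord.
    have -> : [set i | lshift n i \in S0] = ~: I by apply/setP => i; rewrite in_set lS in_setC.
    have -> : [set i | rshift n i \in S0] = ~: J by apply/setP => i; rewrite in_set rS in_setC.
    have := cardsC I; have := cardsC J; rewrite card_ord; move: hm; rewrite /fiber_mult -/I -/J.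
    lia.
  (* The multiplicity may exceed r, so the complement of the clusters may have to be enlarged. *)
  have [|S subS cS] := @exists_superset_card _ S0 (n - r).
    by rewrite cS0 card_ord leq_subLR; lia.
  (* Solve y alpha_i + t u_i = a for u_i, and likewise for beta. *)
  exists S; split=> //; apply/mem_stratum; exists (a / t), (b / t), (- (y / t)).
  split=> i iS.
    have : lshift n i \notin S0 by apply: contra iS => /(subsetP subS).
    rewrite lS negbK inE /fiber_root mxE => /eqP <-; field.
    exact: t0.
  have : rshift n i \notin S0 by apply: contra iS => /(subsetP subS).
  rewrite rS negbK inE /fiber_root mxE => /eqP <-; field.
  exact: t0.
case=> S [cS /mem_stratum [c1 [c2 [c3 [h1 h2]]]]].
(* At this parameter the slope c3 cancels, and all entries outside S collapse to c1 in the first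
   block and to c2 in the second. *)
exists (- c3), 1; split; first by rewrite xpair_eqE oner_eq0 andbF.
exists (c1 + c2); rewrite mup_slice.
have le : (n + r <= fiber_mult alpha beta w (- c3) 1%R c1 c2)%N.
  rewrite /fiber_mult.
  have lI : (#|~: [set i | lshift n i \in S]| <= #|rootset (fiber_root alpha (lsubmx w) (- c3) 1%R) c1|)%N.
    apply/subset_leq_card/subsetP => i; rewrite !inE => iS.
    by rewrite /fiber_root mxE h1 //; apply/eqP; ring.
  have lJ : (#|~: [set i | rshift n i \in S]| <= #|rootset (fiber_root beta (rsubmx w) (- c3) 1%R) c2|)%N.
    apply/subset_leq_card/subsetP => i; rewrite !inE => iS.
    by rewrite /fiber_root mxE h2 //; apply/eqP; ring.
  apply: leq_trans (leq_add lI lJ).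
  have := card_split_ord S; rewrite cS.
  have := cardsC [set i | lshift n i \in S]; have := cardsC [set i | rshift n i \in S].
  rewrite card_ord; lia.
by rewrite fiber_conv_mult; lia.
Qed.
End LinearAlgebra.

(** * The common fiber and the locus of singular curves *)

Section SingularFiber.
Variables (R : realType) (n : nat) (alpha beta : 'rV[R]_n).
Hypotheses (halpha : injective (alpha 0)) (hbeta : injective (beta 0)).

Lemma singular_one_fiber (w : 'rV[R]_(n + n)) : exists y t : R, (y, t) != (0, 0) /\
  forall p : 'rV[R]_3, singular_point (curve alpha beta w) p -> in_fiber y t p.
Proof.
have [[p sp]|no] := boolp.EM (exists p, singular_point (curve alpha beta w) p); last first.
  exists 0, 1; split=> [|p sp]; first by rewrite xpair_eqE oner_eq0 andbF.
  by case: no; exists p.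
(* The fiber of any one singular point serves for all; t is nonzero there, so the ratio of the
   t-coordinates is the scaling factor. *)
have [_ tp] := singular_double halpha sp.
exists (p 0 iy), (p 0 it); split=> [|q sq]; first by rewrite xpair_eqE negb_and tp orbT.
have [_ tq] := singular_double halpha sq.
exists (q 0 it / p 0 it); split; first by rewrite mulf_neq0 ?invr_eq0.
  have E := singular_same_fiber halpha hbeta sq sp.
  by rewrite mulrAC (mulrC _ (p 0 iy)) -E mulfK.
by rewrite divfK.
Qed.

Lemma Sigma2_singular (w : 'rV[R]_(n + n)) : Sigma alpha beta 2 w <->
  exists p : 'rV[R]_3, singular_point (curve alpha beta w) p.
Proof.
split=> [[y [t [yt [x]]]]|[p sp]].
  rewrite mup_slice => dbl.
  pose p : 'rV[R]_3 := \row_j (if j == ix then x else if j == iy then y else t).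
  exists p; apply: double_singular; rewrite ?mxE //=.
  apply: contraNneq yt => p0; rewrite xpair_eqE.
  have := congr1 (fun q : 'rV[R]_3 => q 0 iy) p0; have := congr1 (fun q : 'rV[R]_3 => q 0 it) p0.
  by rewrite !mxE /= => -> ->; rewrite !eqxx.
have [dbl tp] := singular_double halpha sp.
exists (p 0 iy), (p 0 it); rewrite xpair_eqE negb_and tp orbT; split=> //.
by exists (p 0 ix); rewrite mup_slice.
Qed.
End SingularFiber.

Theorem theorem1p6 (R : realType) (n : nat) (hn : (2 <= n)%N)
    (alpha beta : 'rV[R]_n)
    (halpha : injective (alpha 0)) (hbeta : injective (beta 0)) :
  [/\ (* real singularities of every C_w *)
      forall w : 'rV[R]_(n + n),
        (forall p : 'rV[R]_3, singular_point (curve alpha beta w) p ->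
           exists r : nat, (2 <= r)%N /\ ordinary_point (curve alpha beta w) p r)
        /\ (exists y t : R, (y, t) != (0, 0) /\
              forall p : 'rV[R]_3, singular_point (curve alpha beta w) p ->
                in_fiber y t p),
      (* the loci Sigma_r *)
      forall r : nat, (2 <= r <= n)%N ->
        [/\ forall w : 'rV[R]_(n + n),
              Sigma alpha beta r w <->
              exists S : {set 'I_(n + n)},
                #|S| = (n - r)%N /\
                w \in (Lspace alpha beta + coord_space R S)%VS,
            uniq (strata alpha beta (n - r)),
            size (strata alpha beta (n - r)) = 'C(2 * n, n - r)
          & forall V, V \in strata alpha beta (n - r) ->
              \dim V = (n - r + 3)%N],
      forall w : 'rV[R]_(n + n),
        Sigma alpha beta 2 w <->
        exists p : 'rV[R]_3, singular_point (curve alpha beta w) p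
    & forall w : 'rV[R]_(n + n),
        Sigma alpha beta n w <-> w \in Lspace alpha beta].
Proof.
split=> [w|r /andP[r2 rn]|w|w].
- split; last exact: singular_one_fiber.
  by move=> p sp; apply: singular_ordinary sp.
- split=> [w|||V].
  + by apply: Sigma_stratum; rewrite ?r2.
  + by apply: uniq_strata => //; lia.
  + exact: size_strata.
  case/mapP => S; rewrite mem_enum inE => /eqP cS ->.
  by rewrite dim_stratum ?cS //; lia.
- exact: Sigma2_singular.
(* For r = n the only index set is empty, and it contributes the zero subspace. *)
have -> : w \in Lspace alpha beta <-> w \in (Lspace alpha beta + coord_space R set0)%VS.
  by rewrite /coord_space enum_set0 span_nil addv0.
apply: iff_trans (Sigma_stratum _ _ _ _ _) _ => //; first by rewrite hn leqnn.
rewrite subnn; split=> [[S [/eqP]]|h]; last by exists set0; rewrite cards0.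
by rewrite cards_eq0 => /eqP ->.
Qed.
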